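(* Let $d\ge 2$ be an integer, and let $\mathfrak{N}_d^0$ be the category of finitely generated free groups of the variety $\mathfrak{N}_d$ of all nilpotent groups of class at most $d$. Then every automorphism of the category $\mathfrak{N}_d^0$ is inner, i.e. $\mathrm{Aut}\,\mathfrak{N}_d^0=\mathrm{Inn}\,\mathfrak{N}_d^0$.
   Context: Fix a countable set of symbols $X_0=\{x_1,x_2,\ldots,x_n,\ldots\}$. For a variety $\Theta$ of one-sorted algebras, $\Theta^0$ denotes the category whose objects are all free algebras $W(X)$ of $\Theta$ generated by finite subsets $X\subset X_0$, and whose morphisms are all homomorphisms between these algebras. Here $\Theta=\mathfrak{N}_d$ is the variety of all nilpotent groups of class at most $d$. An automorphism $\Upsilon$ of a category $\mathfrak{K}$ is called inner if it is isomorphic, as a functor, to the identity automorphism of $\mathfrak{K}$; in detail, for every object $A$ of $\mathfrak{K}$ there is an isomorphism $s_A^{\Upsilon}:A\to\Upsilon(A)$ in $\mathfrak{K}$ such that for every morphism $\alpha:A\to B$ of $\mathfrak{K}$ one has $\Upsilon(\alpha)\, s_A^{\Upsilon}=s_B^{\Upsilon}\,\alpha$. $\mathrm{Aut}\,\mathfrak{K}$ denotes the group of all automorphisms of $\mathfrak{K}$ and $\mathrm{Inn}\,\mathfrak{K}$ the group of all inner ones. *)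

(* Defs.v *)
From HB Require Import structures.
From mathcomp Require Import all_boot.
From mathcomp Require Import finmap.
From mathcomp Require Import boolp classical_sets.

Set Implicit Arguments.
Unset Strict Implicit.
Unset Printing Implicit Defensive.

Local Open Scope classical_set_scope.
Local Open Scope group_scope.
Local Open Scope quotient_scope.

Record category : Type := Category {
  obj :> Type;
  hom : obj -> obj -> Type;
  idm : forall A, hom A A;
  comp : forall A B C, hom B C -> hom A B -> hom A C;
  comp1m : forall A B (f : hom A B), comp (idm B) f = f;
  compm1 : forall A B (f : hom A B), comp f (idm A) = f;
  compA : forall A B C D (h : hom C D) (g : hom B C) (f : hom A B),
    comp h (comp g f) = comp (comp h g) f }.

Arguments idm {c} A.

Record functor (C D : category) : Type := Functor {
  fobj :> C -> D;
  fmap : forall A B : C, hom A B -> hom (fobj A) (fobj B);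
  fmap1 : forall A : C, fmap (idm A) = idm (fobj A);
  fmapM : forall (A B E : C) (g : hom B E) (f : hom A B),
    fmap (comp g f) = comp (fmap g) (fmap f) }.

Arguments fmap {C D} F {A B} : rename.

Definition functor_id (C : category) : functor C C :=
  @Functor C C id (fun _ _ f => f) (fun _ => erefl) (fun _ _ _ _ _ => erefl).

Section FunctorComp.
Variables (C D E : category) (G : functor D E) (F : functor C D).

Let cobj (A : C) : E := G (F A).
Let cmap (A B : C) (f : hom A B) : hom (cobj A) (cobj B) := fmap G (fmap F f).

Fact functor_comp1 (A : C) : cmap (idm A) = idm (cobj A).
Proof. by rewrite /cmap !fmap1. Qed.

Fact functor_compM (A B H : C) (g : hom B H) (f : hom A B) :
  cmap (comp g f) = comp (cmap g) (cmap f).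
Proof. by rewrite /cmap !fmapM. Qed.

Definition functor_comp : functor C E := Functor functor_comp1 functor_compM.

End FunctorComp.

Definition is_iso (C : category) (A B : C) (f : hom A B) : Prop :=
  exists g : hom B A, comp g f = idm A /\ comp f g = idm B.

(* The equalities are Leibniz equalities of functors: an automorphism is a
   strictly invertible functor, not merely an equivalence. *)
Definition Aut (C : category) : set (functor C C) :=
  [set F | exists G : functor C C,
     functor_comp G F = functor_id C /\ functor_comp F G = functor_id C].

Definition Inn (C : category) : set (functor C C) :=
  [set F | Aut F /\
     exists s : forall A : C, hom A (F A),
       (forall A : C, is_iso (s A)) /\
       (forall (A B : C) (f : hom A B), comp (fmap F f) (s A) = comp (s B) f)].

Arguments Aut C : clear implicits.
Arguments Inn C : clear implicits.

Inductive generated (G : groupType) (S : set G) : set G :=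
| generated_in x : S x -> generated S x
| generated_1 : generated S 1
| generatedM x y : generated S x -> generated S y -> generated S (x * y)
| generatedV x : generated S x -> generated S x^-1.

(* [lower_central G n] is gamma_(n+1) G; the indexing starts with
   [lower_central G 0 = gamma_1 G = G]. *)
Fixpoint lower_central (G : groupType) (n : nat) : set G :=
  if n is m.+1 then
    generated [set z | exists x y : G, lower_central m x /\ z = [~ x, y]]
  else setT.

Definition nilpotent_class_le (d : nat) (G : groupType) : Prop :=
  forall x : G, lower_central d x -> x = 1.

Notation group_hom G H := (UMagmaMorphism.type G H).

Lemma group_hom_eq (G H : groupType) (f g : group_hom G H) :
  f =1 g -> f = g.
Proof.
case: f g => [f [[fM] [f1]]] [g [[gM] [g1]]] /= /funext fg.
move: fM f1 gM g1; rewrite /= in fg *; case: _ / fg => fM f1 gM g1.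
by rewrite (Prop_irrelevance fM gM) (Prop_irrelevance f1 g1).
Qed.

Lemma lower_central_hom (G H : groupType) (f : group_hom G H) n (x : G) :
  lower_central n x -> lower_central n (f x).
Proof.
elim: n x => [//|n IHn] x /=; elim.
- move=> _ [y [z [yn ->]]]; apply: generated_in.
  by exists (f y), (f z); split; [exact: IHn | rewrite gmulfR].
- by rewrite gmulf1; exact: generated_1.
- by move=> y z _ fy _ fz; rewrite gmulfM; exact: generatedM.
- by move=> y _ fy; rewrite gmulfV; exact: generatedV.
Qed.

(* Group words over X: the letter (x, true) is x, and (x, false) is x^-1. *)
Notation word X := (seq (X * bool)).

Definition eval (X : Type) (G : groupType) (a : X -> G) (u : word X) : G :=
  foldr (fun l r => (if l.2 then a l.1 else (a l.1)^-1) * r) 1 u.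

Definition word_inv (X : Type) (u : word X) : word X :=
  rev [seq (l.1, ~~ l.2) | l <- u].

Lemma eval_cat (X : Type) (G : groupType) (a : X -> G) (u v : word X) :
  eval a (u ++ v) = eval a u * eval a v.
Proof. by elim: u => [|l u IHu] /=; rewrite ?mul1g // IHu mulgA. Qed.

Lemma eval_inv (X : Type) (G : groupType) (a : X -> G) (u : word X) :
  eval a (word_inv u) = (eval a u)^-1.
Proof.
elim: u => [|[x b] u IHu] /=; first by rewrite invg1.
rewrite /word_inv /= rev_cons -cats1 eval_cat -/(word_inv u) IHu /= mulg1.
by rewrite invgM; case: b => /=; rewrite ?invgK.
Qed.

Section FreeNilpotent.
Variables (d : nat) (X : choiceType).

(* u ~ v iff u = v is an identity of the variety N_d. *)
Definition word_eq (u v : word X) : bool :=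
  `[< forall G : groupType, nilpotent_class_le d G ->
      forall a : X -> G, eval a u = eval a v >].

Fact word_eq_refl : reflexive word_eq.
Proof. by move=> u; apply/asboolP. Qed.

Fact word_eq_sym : symmetric word_eq.
Proof. by move=> u v; apply/asboolP/asboolP => uv G Gd a; rewrite uv. Qed.

Fact word_eq_trans : transitive word_eq.
Proof.
move=> v u w /asboolP uv /asboolP vw; apply/asboolP => G Gd a.
by rewrite uv // vw.
Qed.

Canonical word_equiv := EquivRel word_eq word_eq_refl word_eq_sym word_eq_trans.

Definition free_nil : Type := {eq_quot word_equiv}.
HB.instance Definition _ := Choice.on free_nil.
HB.instance Definition _ := EqQuotient.on free_nil.

Lemma free_nil_eqP (u v : word X) :
  \pi_free_nil u = \pi_free_nil v <->
  (forall G : groupType, nilpotent_class_le d G ->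
     forall a : X -> G, eval a u = eval a v).
Proof. by split=> [/eqmodP/asboolP | uv]; last exact/eqmodP/asboolP. Qed.

Lemma eval_repr (u : word X) (G : groupType) (a : X -> G) :
  nilpotent_class_le d G -> eval a (repr (\pi_free_nil u)) = eval a u.
Proof. by move=> Gd; apply: (free_nil_eqP _ _).1 => //; rewrite reprK. Qed.

Definition free_nil_one : free_nil := \pi_free_nil [::].
Definition free_nil_mul (p q : free_nil) : free_nil :=
  \pi_free_nil (repr p ++ repr q).
Definition free_nil_inv (p : free_nil) : free_nil :=
  \pi_free_nil (word_inv (repr p)).

Fact free_nil_mulA : associative free_nil_mul.
Proof.
move=> p q r; apply/free_nil_eqP => G Gd a.
by rewrite !(eval_cat, eval_repr) // mulgA.
Qed.

Fact free_nil_mul1 : left_id free_nil_one free_nil_mul.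
Proof.
move=> p; rewrite -[RHS]reprK; apply/free_nil_eqP => G Gd a.
by rewrite !(eval_cat, eval_repr) // mul1g.
Qed.

Fact free_nil_mul1r : right_id free_nil_one free_nil_mul.
Proof.
move=> p; rewrite -[RHS]reprK; apply/free_nil_eqP => G Gd a.
by rewrite !(eval_cat, eval_repr) // mulg1.
Qed.

Fact free_nil_mulV : left_inverse free_nil_one free_nil_inv free_nil_mul.
Proof.
move=> p; apply/free_nil_eqP => G Gd a.
by rewrite !(eval_cat, eval_repr, eval_inv) // mulVg.
Qed.

Fact free_nil_mulVr : right_inverse free_nil_one free_nil_inv free_nil_mul.
Proof.
move=> p; apply/free_nil_eqP => G Gd a.
by rewrite !(eval_cat, eval_repr, eval_inv) // mulgV.
Qed.

HB.instance Definition _ := isGroup.Build free_nil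
  free_nil_mulA free_nil_mul1 free_nil_mul1r free_nil_mulV free_nil_mulVr.

Definition free_nil_gen (x : X) : free_nil := \pi_free_nil [:: (x, true)].

Section Lift.
Variables (G : groupType) (Gd : nilpotent_class_le d G) (a : X -> G).

Definition free_nil_lift_fun (p : free_nil) : G := eval a (repr p).

Fact free_nil_lift_morphism : monoid_morphism free_nil_lift_fun.
Proof.
by split=> [|p q]; rewrite /free_nil_lift_fun eval_repr // eval_cat.
Qed.

HB.instance Definition _ := isUMagmaMorphism.Build free_nil G
  free_nil_lift_fun free_nil_lift_morphism.

Definition free_nil_lift : group_hom free_nil G := free_nil_lift_fun.

End Lift.

Lemma free_nil_word (u : word X) : \pi_free_nil u = eval free_nil_gen u.
Proof.
elim: u => [//|[x b] u IHu]; rewrite /= -IHu.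
suff -> : (if b then free_nil_gen x else (free_nil_gen x)^-1) =
          \pi_free_nil [:: (x, b)].
  by apply/free_nil_eqP => G Gd a; rewrite !(eval_cat, eval_repr) //= mulg1.
case: b => //; apply/free_nil_eqP => G Gd a.
by rewrite eval_inv eval_repr //= !mulg1.
Qed.

Lemma free_nil_nilpotent : nilpotent_class_le d free_nil.
Proof.
move=> p pd; rewrite -[p]reprK; apply/free_nil_eqP => G Gd a.
exact/Gd/(lower_central_hom (free_nil_lift Gd a)).
Qed.

Lemma free_nil_universal (G : groupType) (a : X -> G) :
  nilpotent_class_le d G ->
  exists! f : group_hom free_nil G, forall x, f (free_nil_gen x) = a x.
Proof.
move=> Gd; exists (free_nil_lift Gd a); split=> [x | f fa].
  by rewrite /= /free_nil_lift_fun eval_repr //= mulg1.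
apply: group_hom_eq => p; rewrite -[p]reprK [LHS]eval_repr // free_nil_word.
elim: (repr p) => [|[x b] u IHu]; first by rewrite gmulf1.
by rewrite /= gmulfM -IHu; case: b; rewrite /= ?gmulfV fa.
Qed.

End FreeNilpotent.

(* The category N_d^0. The alphabet X_0 is nat.  As W(X) contains X, the algebras W(X) for
   distinct finite X are distinct objects, so an object is recorded by X. *)
Section FreeNilpotentCategory.
Variable d : nat.

Definition W (X : {fset nat}) : groupType := free_nil d X.

Definition whom (X Y : {fset nat}) : Type := group_hom (W X) (W Y).
Definition widm (X : {fset nat}) : whom X X := idfun.
Definition wcomp (X Y Z : {fset nat}) (g : whom Y Z) (f : whom X Y) :
  whom X Z := g \o f.

Fact wcomp1m (X Y : {fset nat}) (f : whom X Y) : wcomp (widm Y) f = f.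
Proof. exact: group_hom_eq. Qed.

Fact wcompm1 (X Y : {fset nat}) (f : whom X Y) : wcomp f (widm X) = f.
Proof. exact: group_hom_eq. Qed.

Fact wcompA (X Y Z T : {fset nat})
    (h : whom Z T) (g : whom Y Z) (f : whom X Y) :
  wcomp h (wcomp g f) = wcomp (wcomp h g) f.
Proof. exact: group_hom_eq. Qed.

Definition nilpotent_free_category : category :=
  Category wcomp1m wcompm1 wcompA.

End FreeNilpotentCategory.

(* Main.v *)
Require Import Defs.
From HB Require Import structures.
From mathcomp Require Import all_boot ssralg ssrnum ssrint zmodp ring zify.
From mathcomp Require Import finmap.
From mathcomp Require Import boolp classical_sets.

(* Let s_X : W(X) -> F(W(X)) send an element a to F(a^)(g), where a^ maps the
   generator of W({x}) to a and g generates F(W({x})), of rank 1 since F preserves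
   retracts and hence ranks.  These bijections are natural, so the group law they
   pull back to W(X) is given by a word u(a, b), and it remains to show that u is
   ab or ba: s_X, or s_X followed by the inverse, is then an isomorphism of functors.
   Modulo the third term of the lower central series, u = ab [a, b]^m, and since the
   original law is in turn a word in the new one, 1 + 2m is invertible: m is 0 or
   -1, and in the second case one passes to u(b, a).  If u = ab c(a, b) with c in
   gamma_j modulo gamma_(j+1), j > 2, associativity gives
   c(a^2, b^2) c(b, a) = c(a, b)^3, while c(a^2, b^2) = c(a, b)^(2^j).
   Hence c(b, a) = c(a, b)^-1 and c(a, b)^(2^j - 4) = 1, because gamma_j / gamma_(j+1)
   is torsion-free for a free group: it is spanned by the brackets of Lyndon words,
   whose Magnus expansions have distinct leading words with coefficient 1. *)

(** Degree two must be treated apart because 2^j - 4 vanishes at j = 2, and in class two the law ab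
    [a, b]^m is associative for every m. What restricts m is reversibility: since F is full, the old
    law is also a word in the new one, and the Heisenberg group turns this into an equation between
    integers. In higher degree everything rests on c(a, b) = 1 for commuting a and b: the two laws
    then have the same squares, so products of squares can be computed in two ways. Identities of
    the new law, found on the objects W(X), hold in the whole variety because three elements of a
    group of class at most d are images of free generators. This allows u to be tested in groups
    that are not free. *)

Set Implicit Arguments.
Unset Strict Implicit.
Unset Printing Implicit Defensive.

Local Open Scope classical_set_scope.
Local Open Scope group_scope.
Local Open Scope quotient_scope.

Local Notation lc := lower_central.


(** * The lower central series *)

Section CommutatorCalculus.
Variable G : groupType.
Implicit Types (x y z g h : G) (S T : set G).

Definition subgroup S : Prop :=
  [/\ S 1, forall x y, S x -> S y -> S (x * y) & forall x, S x -> S x^-1].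

Lemma generated_subgroup S : subgroup (generated S).
Proof.
by split; [exact: generated_1 | exact: generatedM | exact: generatedV].
Qed.

Lemma generated_sub S T : subgroup T -> S `<=` T -> generated S `<=` T.
Proof.
move=> [T1 TM TV] ST x; elim=> [y /ST //|//|y z _ Ty _ Tz|y _ Ty].
  exact: TM.
exact: TV.
Qed.

Lemma lc_subgroup n : subgroup (@lc G n).
Proof. by case: n => [|n]; [| exact: generated_subgroup]. Qed.

Lemma lc1 n : lc n (1 : G).
Proof. by case: (lc_subgroup n). Qed.

Lemma lcM n x y : lc n x -> lc n y -> lc n (x * y).
Proof. by case: (lc_subgroup n) => _ + _; apply. Qed.

Lemma lcV n x : lc n x -> lc n x^-1.
Proof. by case: (lc_subgroup n) => _ _; apply. Qed.

Lemma lc_commS n x y : lc n x -> lc n.+1 [~ x, y].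
Proof. by move=> xn; apply: generated_in; exists x, y. Qed.

Lemma lcS n : @lc G n.+1 `<=` lc n.
Proof.
elim: n => [//|n IHn]; apply: generated_sub; first exact: lc_subgroup.
by move=> _ [x [y [xn ->]]]; apply: lc_commS; apply: IHn.
Qed.

Lemma lc_le m n x : m <= n -> lc n x -> lc m x.
Proof. by move=> /subnK <-; elim: (n - m)%N => // k IHk /lcS. Qed.

Lemma lcJ n x g : lc n x -> lc n (x ^ g).
Proof.
move=> xn; have -> : x ^ g = x * [~ x, g] by rewrite /commg mulVKg.
by apply: lcM => //; apply/lcS/lc_commS.
Qed.

Lemma lcJ_iff n x g : lc n (x ^ g) <-> lc n x.
Proof. by split=> [/(@lcJ _ _ g^-1)|/lcJ //]; rewrite conjgK. Qed.

Lemma commg_mull x y z : [~ x * y, z] = [~ x, z] ^ y * [~ y, z].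
Proof. by rewrite /commg /conjg !gnorm. Qed.

Lemma commg_mulr x y z : [~ x, y * z] = [~ x, z] * [~ x, y] ^ z.
Proof. by rewrite /commg /conjg !gnorm. Qed.

Lemma commg_invl x y : [~ x^-1, y] = ([~ x, y] ^ x^-1)^-1.
Proof. by rewrite /commg /conjg !gnorm. Qed.

Lemma commg_invr x y : [~ x, y^-1] = ([~ x, y] ^ y^-1)^-1.
Proof. by rewrite /commg /conjg !gnorm. Qed.

Lemma Hall_Witt x y z :
  [~ [~ x, y^-1], z] ^ y * [~ [~ y, z^-1], x] ^ z * [~ [~ z, x^-1], y] ^ x = 1.
Proof. by rewrite /commg /conjg !gnorm. Qed.

Lemma mulg3_eq1 x y z : x * y * z = 1 -> y = x^-1 * z^-1.
Proof. by move=> /mulg1_eq <-; rewrite invgK mulKg. Qed.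

(** Induction on [j]. A generator of [lc j.+1] is [[~ y, g]] with [y] in [lc j], and the Hall-Witt
    identity expresses its bracket with [x] by two brackets covered by the induction hypothesis.
    Elements of [lc i] have weight [i.+1], whence the shift in [(i + j).+1]. *)
Lemma lc_comm i j x y : lc i x -> lc j y -> lc (i + j).+1 [~ x, y].
Proof.
elim: j i x y => [|j IHj] i x y xi; first by rewrite addn0 => _; exact: lc_commS.
move: y; apply: generated_sub.
  split=> [|y z xy xz|y xy]; first by rewrite commg1; exact: lc1.
    by rewrite commg_mulr; apply: lcM => //; apply: lcJ.
  by rewrite commg_invr; apply/lcV/lcJ.
move=> _ [y [g [yj ->]]].
rewrite -invgR; apply/lcV/(@lcJ_iff _ _ g^-1).
have A : lc (i + j.+1).+1 ([~ [~ x, y^-1], g^-1] ^ y).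
  by apply: lcJ; rewrite addnS; apply/lc_commS/IHj => //; exact: lcV.
have C : lc (i + j.+1).+1 ([~ [~ g^-1, x^-1], y] ^ x).
  apply: lcJ; rewrite -addSnnS; apply: IHj => //; rewrite -invgR.
  by apply/lcV/lc_commS/lcV.
have := Hall_Witt x y g^-1; rewrite invgK => /mulg3_eq1 ->.
by apply: lcM; apply: lcV.
Qed.

Definition eqm n x y : Prop := lc n (x^-1 * y).

Lemma eqm_refl n x : eqm n x x.
Proof. by rewrite /eqm mulVg; exact: lc1. Qed.

Lemma eqm_sym n x y : eqm n x y -> eqm n y x.
Proof. by move/lcV; rewrite invgM invgK. Qed.

Lemma eqm_trans n y x z : eqm n x y -> eqm n y z -> eqm n x z.
Proof. by move=> xy yz; have := lcM xy yz; rewrite mulgA mulgK. Qed.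

Lemma eqm_mulr n x h : lc n h -> eqm n x (x * h).
Proof. by rewrite /eqm mulKg. Qed.

Lemma eqm_mull n x h : lc n h -> eqm n x (h * x).
Proof. by move=> hn; rewrite conjgC; apply/eqm_mulr/lcJ. Qed.

Lemma eqmP n x y : eqm n x y -> exists2 h, lc n h & y = x * h.
Proof. by move=> xy; exists (x^-1 * y) => //; rewrite mulVKg. Qed.

Lemma eqmM n x x' y y' : eqm n x x' -> eqm n y y' -> eqm n (x * y) (x' * y').
Proof.
move=> /eqmP[h hn ->] /eqmP[k kn ->].
have -> : x * h * (y * k) = x * y * (h ^ y * k) by rewrite /conjg !gnorm.
by apply/eqm_mulr/lcM => //; apply: lcJ.
Qed.

Lemma eqmV n x y : eqm n x y -> eqm n x^-1 y^-1.
Proof. by move=> /eqmP[h hn ->]; rewrite invgM; apply/eqm_mull/lcV. Qed.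

Lemma eqmX n k x y : eqm n x y -> eqm n (x ^+ k) (y ^+ k).
Proof.
move=> xy; elim: k => [|k IHk]; first exact: eqm_refl.
by rewrite !expgS; apply: eqmM.
Qed.

Lemma eqm_conj n x g : lc n [~ x, g] -> eqm n x (x ^ g).
Proof. by []. Qed.

Lemma eqm_comml i j x x' y :
  eqm i x x' -> lc j y -> eqm (i + j).+1 [~ x, y] [~ x', y].
Proof.
move=> /eqmP[h hi ->] yj; rewrite commg_mull.
apply: (eqm_trans (y := [~ x, y] ^ h)); last exact/eqm_mulr/lc_comm.
apply: eqm_conj; rewrite -invgR; apply: lcV.
apply: (@lc_le _ (i + j.+1).+1); first by rewrite addnS.
by apply: lc_comm => //; rewrite -invgR; apply/lcV/lc_commS.
Qed.

Lemma eqm_commr i j x y y' :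
  lc i x -> eqm j y y' -> eqm (i + j).+1 [~ x, y] [~ x, y'].
Proof.
move=> xi yy; rewrite -(invgR y) -(invgR y') addnC.
exact/eqmV/eqm_comml.
Qed.

Lemma eqm_commMl i j x x' y : lc i x -> lc i x' -> lc j y ->
  eqm (i + j).+2 ([~ x, y] * [~ x', y]) [~ x * x', y].
Proof.
move=> xi xi' yj; rewrite commg_mull; apply: eqmM (eqm_refl _ _).
by apply/eqm_conj/lc_commS/lc_comm.
Qed.

Lemma eqm_commVl i j x y : lc i x -> lc j y ->
  eqm (i + j).+2 [~ x, y]^-1 [~ x^-1, y].
Proof.
move=> xi yj; rewrite commg_invl; apply: eqmV.
by apply/eqm_conj/lc_commS/lc_comm.
Qed.

Lemma eqm_commVr i j x y : lc i x -> lc j y ->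
  eqm (i + j).+2 [~ x, y]^-1 [~ x, y^-1].
Proof.
move=> xi yj; rewrite commg_invr; apply: eqmV.
by apply/eqm_conj/lc_commS/lc_comm.
Qed.

Lemma eqm_commXl i j k x y : lc i x -> lc j y ->
  eqm (i + j).+2 ([~ x, y] ^+ k) [~ x ^+ k, y].
Proof.
move=> xi yj; elim: k => [|k IHk]; first by rewrite comm1g; exact: eqm_refl.
rewrite !expgS; apply: (eqm_trans (eqmM (eqm_refl _ _) IHk)).
apply: eqm_commMl => //; elim: k {IHk} => [|k IHk]; first exact: lc1.
by rewrite expgS; apply: lcM.
Qed.

Lemma eqm_commXr i j k x y : lc i x -> lc j y ->
  eqm (i + j).+2 ([~ x, y] ^+ k) [~ x, y ^+ k].
Proof.
move=> xi yj; rewrite -(invgR y x) -(invgR (y ^+ k)) expVgn addnC.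
exact/eqmV/eqm_commXl.
Qed.

Lemma subgroup_eqm n S x y :
  subgroup S -> @lc G n `<=` S -> eqm n x y -> S x <-> S y.
Proof.
move=> [_ SM SV] nS xy; split=> [Sx|Sy].
  by rewrite -[y](mulVKg x); apply: SM => //; apply: nS.
by rewrite -[x](mulVKg y); apply: SM => //; apply/nS/eqm_sym.
Qed.

Lemma subgroupV S x : subgroup S -> S x^-1 -> S x.
Proof. by move=> [_ _ SV] /SV; rewrite invgK. Qed.

Lemma subgroup_commC S x y : subgroup S -> S [~ x, y] -> S [~ y, x].
Proof. by move=> [_ _ SV] /SV; rewrite invgR. Qed.

(* The Jacobi identity, as the Hall-Witt identity modulo [lc (i + j + k + 3)]. *)
Lemma subgroup_Jacobi i j k x y z S : subgroup S ->
  @lc G (i + j + k).+3 `<=` S -> lc i x -> lc j y -> lc k z ->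
  S [~ [~ x, z], y] -> S [~ x, [~ y, z]] -> S [~ [~ x, y], z].
Proof.
move=> sS nS xi yj zk Sxzy Sxyz; set n := (i + j + k).+3 in nS.
have iff := subgroup_eqm sS nS; have [S1 SM SV] := sS.
(* Modulo [lc n] each Hall-Witt factor is the inverse of the plain triple bracket: the inverse moves
   out of both brackets and the conjugation disappears. *)
have step a b c p q r : lc p a -> lc q b -> lc r c -> (p + q + r).+3 = n ->
    eqm n [~ [~ a, b], c]^-1 ([~ [~ a, b^-1], c] ^ b).
  move=> ap bq cr nE.
  apply: (eqm_trans (y := [~ [~ a, b^-1], c])); last first.
    apply: eqm_conj; rewrite -nE; apply: lc_commS.
    rewrite -[(p + q + r).+1]addSn; apply: lc_comm => //.
    by apply: lc_comm => //; exact: lcV.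
  apply: (eqm_trans (y := [~ [~ a, b]^-1, c])).
    rewrite -nE -[(p + q + r).+1]addSn.
    by apply: eqm_commVl => //; exact: lc_comm.
  rewrite -nE -[(p + q + r).+2]/((p + q).+2 + r).
  by apply: eqm_comml => //; exact: eqm_commVr.
have E := Hall_Witt x y z.
have e1 := step _ _ _ _ _ _ xi yj zk erefl.
have e2 : eqm n [~ [~ y, z], x]^-1 ([~ [~ y, z^-1], x] ^ z).
  by apply: (step _ _ _ _ _ _ yj zk xi); rewrite /n -(addnA i) (addnC i).
have e3 : eqm n [~ [~ z, x], y]^-1 ([~ [~ z, x^-1], y] ^ x).
  by apply: (step _ _ _ _ _ _ zk xi yj); rewrite /n (addnC k) addnAC.
have S2 : S ([~ [~ y, z^-1], x] ^ z) by apply/(iff _ _ e2); rewrite invgR.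
have S3 : S ([~ [~ z, x^-1], y] ^ x).
  apply/(iff _ _ e3)/SV; rewrite -(invgR x z).
  have e : eqm n [~ [~ x, z], y]^-1 [~ [~ x, z]^-1, y].
    rewrite /n addnAC -[(i + k + j).+1]addSn.
    by apply: eqm_commVl => //; exact: lc_comm.
  exact/(iff _ _ e)/SV.
apply: (subgroupV sS); apply/(iff _ _ e1).
rewrite (_ : _ ^ y = ([~ [~ y, z^-1], x] ^ z * [~ [~ z, x^-1], y] ^ x)^-1).
  by apply/SV/SM.
by apply: invg_inj; rewrite invgK; apply: mulg1_eq; rewrite mulgA.
Qed.

End CommutatorCalculus.


(** * Quotients by the terms of the lower central series *)

Section NilpotentQuotient.
Variables (G : groupType) (n : nat).

Definition eqmb (x y : G) : bool := `[< eqm n x y >].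

Fact eqmb_refl : reflexive eqmb.
Proof. by move=> x; apply/asboolP/eqm_refl. Qed.

Fact eqmb_sym : symmetric eqmb.
Proof. by move=> x y; apply/asboolP/asboolP => /eqm_sym. Qed.

Fact eqmb_trans : transitive eqmb.
Proof.
by move=> y x z /asboolP xy /asboolP yz; apply/asboolP/(eqm_trans xy yz).
Qed.

Canonical eqmb_equiv := EquivRel eqmb eqmb_refl eqmb_sym eqmb_trans.

(** This makes a member of the variety N_n out of any group, so that the universal property of
    [free_nil] and the identities of N_n apply to it. *)
Definition nil_quot : Type := {eq_quot eqmb_equiv}.
HB.instance Definition _ := Choice.on nil_quot.
HB.instance Definition _ := EqQuotient.on nil_quot.

Local Notation pi := (\pi_nil_quot).

Lemma nil_quotP (x y : G) : pi x = pi y <-> eqm n x y.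
Proof. by split=> [/eqmodP/asboolP | xy]; last exact/eqmodP/asboolP. Qed.

Lemma eqm_repr (x : G) : eqm n (repr (pi x)) x.
Proof. by apply/nil_quotP; rewrite reprK. Qed.

Definition nil_quot_mul (p q : nil_quot) : nil_quot := pi (repr p * repr q).
Definition nil_quot_inv (p : nil_quot) : nil_quot := pi (repr p)^-1.

Lemma pi_mul (x y : G) : nil_quot_mul (pi x) (pi y) = pi (x * y).
Proof. by apply/nil_quotP/eqmM; exact: eqm_repr. Qed.

Lemma pi_inv (x : G) : nil_quot_inv (pi x) = pi x^-1.
Proof. by apply/nil_quotP/eqmV/eqm_repr. Qed.

Fact nil_quot_mulA : associative nil_quot_mul.
Proof.
move=> p q r; rewrite -[p]reprK -[q]reprK -[r]reprK.
by rewrite (pi_mul (repr q)) (pi_mul (repr p) (repr q)) !pi_mul mulgA.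
Qed.

Fact nil_quot_mul1 : left_id (pi 1) nil_quot_mul.
Proof. by move=> p; rewrite -[p]reprK !pi_mul mul1g. Qed.

Fact nil_quot_mul1r : right_id (pi 1) nil_quot_mul.
Proof. by move=> p; rewrite -[p]reprK !pi_mul mulg1. Qed.

Fact nil_quot_mulV : left_inverse (pi 1) nil_quot_inv nil_quot_mul.
Proof. by move=> p; rewrite -[p]reprK pi_inv pi_mul mulVg. Qed.

Fact nil_quot_mulVr : right_inverse (pi 1) nil_quot_inv nil_quot_mul.
Proof. by move=> p; rewrite -[p]reprK pi_inv pi_mul mulgV. Qed.

HB.instance Definition _ := isGroup.Build nil_quot
  nil_quot_mulA nil_quot_mul1 nil_quot_mul1r nil_quot_mulV nil_quot_mulVr.

Definition nil_quot_pi (x : G) : nil_quot := pi x.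

Fact nil_quot_pi_morphism : monoid_morphism nil_quot_pi.
Proof. by split=> [|x y]; rewrite /nil_quot_pi -?pi_mul. Qed.

HB.instance Definition _ := isUMagmaMorphism.Build G nil_quot
  nil_quot_pi nil_quot_pi_morphism.

Lemma nil_quot_pi_eqP (x y : G) : nil_quot_pi x = nil_quot_pi y <-> eqm n x y.
Proof. exact: nil_quotP. Qed.

Lemma nil_quot_pi1 (x : G) : nil_quot_pi x = 1 <-> lc n x.
Proof.
have -> : nil_quot_pi x = 1 <-> nil_quot_pi x = nil_quot_pi 1 by rewrite gmulf1.
rewrite nil_quot_pi_eqP; split=> [/eqm_sym|xn]; first by rewrite /eqm invg1 mul1g.
by apply: eqm_sym; rewrite /eqm invg1 mul1g.
Qed.

Lemma nil_quot_pi_surj (q : nil_quot) : exists x, q = nil_quot_pi x.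
Proof. by exists (repr q); rewrite /nil_quot_pi reprK. Qed.

End NilpotentQuotient.

Lemma lower_central_surj (G H : groupType) (f : group_hom G H) n (y : H) :
  (forall z : H, exists x : G, z = f x) ->
  lc n y -> exists2 x, lc n x & y = f x.
Proof.
move=> fs; elim: n y => [|n IHn] y; first by case: (fs y) => x ->; exists x.
elim=> [_ [u [v [/IHn[u' u'n ->] ->]]]||u v _ [u' u'n ->] _ [v' v'n ->]|
        u _ [u' u'n ->]].
- case: (fs v) => v' ->; exists [~ u', v']; first exact: lc_commS.
  by rewrite gmulfR.
- by exists 1; [exact: lc1 | rewrite gmulf1].
- by exists (u' * v'); [exact: lcM | rewrite gmulfM].
- by exists u'^-1; [exact: lcV | rewrite gmulfV].
Qed.

Lemma nil_quot_nilpotent (G : groupType) n :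
  nilpotent_class_le n (nil_quot G n).
Proof.
move=> q /(lower_central_surj (f := @nil_quot_pi G n)) [|x xn ->].
  exact: nil_quot_pi_surj.
exact/nil_quot_pi1.
Qed.

Lemma nilpotent_class_leW m n (G : groupType) :
  m <= n -> nilpotent_class_le m G -> nilpotent_class_le n G.
Proof. by move=> mn Gm x /(lc_le mn)/Gm. Qed.

Lemma eval_hom (X : Type) (G H : groupType) (f : group_hom G H) (a : X -> G)
  (u : word X) : f (eval a u) = eval (f \o a) u.
Proof.
elim: u => [|[x b] u IHu] /=; first exact: gmulf1.
by rewrite gmulfM IHu; case: b => //=; rewrite gmulfV.
Qed.

Lemma eq_eval (X : Type) (G : groupType) (a b : X -> G) (u : word X) :
  a =1 b -> eval a u = eval b u.
Proof. by move=> ab; elim: u => [//|[x c] u IHu] /=; rewrite IHu ab. Qed.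

Lemma eval_map (X Y : Type) (h : X -> Y) (G : groupType) (a : Y -> G)
  (u : word X) : eval a [seq (h l.1, l.2) | l <- u] = eval (a \o h) u.
Proof. by elim: u => [//|[x c] u IHu] /=; rewrite IHu. Qed.

(* A word that is an identity of the variety N_n takes values in gamma_(n+1)
   in every group. *)
Lemma eval_lower_central (X : Type) n (u v : word X) :
  (forall G : groupType, nilpotent_class_le n G ->
     forall a : X -> G, eval a u = eval a v) ->
  forall (G : groupType) (a : X -> G), eqm n (eval a u) (eval a v).
Proof.
move=> uv G a; apply/nil_quot_pi_eqP; rewrite !eval_hom.
exact/uv/nil_quot_nilpotent.
Qed.

Section Lift.
Variables (d : nat) (X : choiceType) (G : groupType).
Hypothesis Gd : nilpotent_class_le d G.

Lemma free_nil_liftE (a : X -> G) x :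
  free_nil_lift Gd a (free_nil_gen d x) = a x.
Proof. by rewrite /= /free_nil_lift_fun eval_repr //= mulg1. Qed.

Lemma free_nil_hom_eq (f g : group_hom (free_nil d X) G) :
  (forall x, f (free_nil_gen d x) = g (free_nil_gen d x)) -> f = g.
Proof.
move=> fg.
have [h [_ hU]] := free_nil_universal (fun x => f (free_nil_gen d x)) Gd.
by rewrite -(hU f) // -(hU g).
Qed.

End Lift.

Lemma free_nil_evalE d (X : choiceType) (p : free_nil d X) :
  exists u : word X, p = eval (@free_nil_gen d X) u.
Proof. by exists (repr p); rewrite -free_nil_word reprK. Qed.


(** * Lyndon words and the lower central series *)

Fixpoint lex (u v : seq bool) : bool :=
  match u, v with
  | _, [::] => false
  | [::], _ => true
  | x :: u', y :: v' => (~~ x && y) || (x == y) && lex u' v'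
  end.

Lemma lexxx u : lex u u = false.
Proof. by elim: u => //= [[] u ->]. Qed.

Lemma lex_trans : transitive lex.
Proof.
elim=> [|y v IHv] [|x u] [|z w] //=.
by case: x; case: y; case: z => //=; exact: IHv.
Qed.

Lemma lex_total u v : u != v -> lex u v || lex v u.
Proof.
elim: u v => [|x u IHu] [|y v] //=; rewrite eqseq_cons.
by case: x; case: y => //= /IHu.
Qed.

Lemma lexN_trans u v w : ~~ lex v u -> lex v w -> lex u w.
Proof.
by have [->//|/lex_total] := eqVneq u v; case: (lex v u) => //=; rewrite orbF => + _;
   exact: lex_trans.
Qed.

Lemma lex_transN u v w : lex u v -> ~~ lex w v -> lex u w.
Proof.
by have [->//|/lex_total] := eqVneq v w; case: (lex w v) => //=; rewrite orbF => + + _;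
   move=> vw uv; exact: lex_trans vw.
Qed.

Lemma lex_catl u v w : lex (u ++ v) (u ++ w) = lex v w.
Proof. by elim: u => //= -[] u ->. Qed.

Lemma lex_prefix u v : ~~ lex (u ++ v) u.
Proof. by elim: u => [|x u IHu] /=; [case: v | case: x]. Qed.

Lemma lex_cat2 u v u' v' : size u = size u' -> lex u u' ->
  lex (u ++ v) (u' ++ v').
Proof.
elim: u u' => [[]//|x u IHu] [//|y u'] /= [su].
by case: (_ && y) => //= /andP[-> /IHu]; apply.
Qed.

(** Either [u] and [v] differ at some letter, and appending [w] to [u] changes nothing, or [v]
    extends [u], which is the case left to the hypothesis. *)
Lemma lex_cat_lt u v w : lex u v ->
  (forall v', v = u ++ v' -> lex (u ++ w) v) -> lex (u ++ w) v.
Proof.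
elim: u v => [|x u IHu] [|y v] //=; first by move=> _ /(_ (y :: v)) ->.
case: (_ && y) => //= /andP[/eqP <- uv] H; rewrite eqxx /=; apply: IHu => // v' E.
by have := H v'; rewrite E lex_catl; case: (x) => /=; apply.
Qed.

(** Base 3 with digits 1 and 2 for the letters and 0 past the end of the word. It turns [lex] on
    words of bounded length into the order of natural numbers, on which one can do induction. *)
Fixpoint lex_code (m : nat) (w : seq bool) : nat :=
  match m, w with
  | m'.+1, x :: w' => ((x : nat).+1 * 3 ^ m' + lex_code m' w')%N
  | _, _ => 0%N
  end.

Lemma lex_code_lt m u v :
  size u <= m -> size v <= m -> lex u v -> (lex_code m u < lex_code m v)%N.
Proof.
have bound k w : (lex_code k w < 3 ^ k)%N.
  elim: k w => [|k IHk] [|x w] //=; first by rewrite expn_gt0.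
  rewrite expnS; apply: (@leq_trans ((x : nat).+1 * 3 ^ k + 3 ^ k)).
    by rewrite ltn_add2l.
  by rewrite -mulSnr leq_mul2r; case: x; rewrite orbT.
elim: m u v => [|m IHm] [|x u] [|y v] //=; rewrite ?ltnS.
  by move=> _ _ _; rewrite addn_gt0 muln_gt0 expn_gt0.
move=> su sv /orP[|/andP[/eqP-> uv]]; last by rewrite ltn_add2l; apply: IHm.
case: x y => [] [] //= _; rewrite mul1n mulSn mul1n -addnA ltn_add2l.
exact: (leq_trans (bound _ _) (leq_addr _ _)).
Qed.

Inductive tree := Leaf of bool | Node of tree & tree.

HB.instance Definition _ := gen_eqMixin tree.

Fixpoint fol (t : tree) : seq bool :=
  match t with Leaf x => [:: x] | Node t1 t2 => fol t1 ++ fol t2 end.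

Definition degree (t : tree) : nat := size (fol t).

(** Lyndon words with their standard bracketing. The last clause selects one bracketing for each
    word: of the trees for 0011, it rejects ((0 (01)) 1) and keeps (0 ((01) 1)). *)
Fixpoint lyndon (t : tree) : bool :=
  match t with
  | Leaf _ => true
  | Node t1 t2 => [&& lyndon t1, lyndon t2, lex (fol t1) (fol t2) &
      (if t1 is Node _ t12 then ~~ lex (fol t12) (fol t2) else true)]
  end.

Lemma degree_gt0 t : (0 < degree t)%N.
Proof.
by rewrite /degree; elim: t => //= t1 IH1 t2 IH2; rewrite size_cat addn_gt0 IH1.
Qed.

Lemma fol_neq0 t : fol t != [::].
Proof. by rewrite -size_eq0 -lt0n degree_gt0. Qed.

Lemma degreeN t1 t2 : degree (Node t1 t2) = (degree t1 + degree t2)%N.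
Proof. exact: size_cat. Qed.

Lemma cat_split (T : Type) (s1 s2 u v : seq T) : s1 ++ s2 = u ++ v ->
  (exists2 r, u = s1 ++ r & s2 = r ++ v) \/
  (exists2 r, s1 = u ++ r & v = r ++ s2).
Proof.
elim: s1 u => [|x s1 IH] [|y u] /=.
- by left; exists [::].
- by move=> ->; left; exists (y :: u).
- by move=> <-; right; exists (x :: s1).
by case=> <- /IH[[r -> ->]|[r -> ->]]; [left|right]; exists r.
Qed.

(* [fol t] is a Lyndon word, and [fol t2] is its least proper suffix. *)
Lemma lyndon_suffix t : lyndon t ->
  (forall u v, fol t = u ++ v -> u != [::] -> v != [::] -> lex (fol t) v) /\
  (forall u v, fol t = u ++ v -> u != [::] -> v != [::] ->
     if t is Node _ t2 then lex (fol t) (fol t2) /\ ~~ lex v (fol t2) else True).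
Proof.
elim: t => [x _|t1 IH1 t2 IH2 /= /and4P[l1 l2 lt12 std]].
  by split=> [[|y [|? ?]] [|z v]|].
have [L1 M1] := IH1 l1; have [L2 _] := IH2 l2.
have catlt : lex (fol t1 ++ fol t2) (fol t2).
  apply: lex_cat_lt => // v' E; rewrite {2}E lex_catl.
  apply: (L2 (fol t1)) => //; first exact: fol_neq0.
  by apply: contraL lt12 => /eqP v0; rewrite E v0 cats0 lexxx.
(* A suffix inside [fol t2] is handled by the induction hypothesis for [t2]. Otherwise it is
   [r ++ fol t2] with [r] a suffix of [fol t1]; if it were smaller than [fol t2], so would be [r],
   hence also the least suffix [fol t12] of [fol t1], against the last clause of [lyndon]. *)
have M u v : fol t1 ++ fol t2 = u ++ v -> u != [::] -> v != [::] ->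
    ~~ lex v (fol t2).
  move=> /cat_split[[r Eu E2]|[r E1 ->]] u0 v0.
    have [r0|r0] := eqVneq r [::]; first by rewrite E2 r0 lexxx.
    by apply/negP => /(lex_trans (L2 _ _ E2 r0 v0)); rewrite lexxx.
  have [->/=|r0] := eqVneq r [::]; first by rewrite lexxx.
  apply/negP => lt_r2; have {lt_r2} : lex r (fol t2).
    exact: lexN_trans (lex_prefix _ _) lt_r2.
  case: t1 E1 M1 std {IH1 l1 lt12 L1 catlt} => [x|t11 t12] E1 M1 std.
    by case: u E1 u0 => [//|y [|]] //= [_ /esym/eqP]; rewrite (negPf r0).
  have [_ rt] := M1 _ _ E1 u0 r0 => r2.
  by move: std; rewrite (lexN_trans rt r2).
by split=> u v E u0 v0; [exact: lex_transN catlt (M _ _ E u0 v0) | split=> //; exact: M E u0 v0].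
Qed.

Lemma lyndon_lt t1 t2 : lyndon (Node t1 t2) -> lex (fol t1 ++ fol t2) (fol t2).
Proof.
move=> l; have [_ M] := lyndon_suffix l.
by have [] := M (fol t1) (fol t2) erefl (fol_neq0 _) (fol_neq0 _).
Qed.

(** The right subtrees both carry the least proper suffix of the common word, so the word is cut at
    the same place. *)
Lemma fol_inj t t' : lyndon t -> lyndon t' -> fol t = fol t' -> t = t'.
Proof.
have leafN x t1 t2 : fol (Leaf x) <> fol (Node t1 t2).
  move=> /(congr1 size); rewrite size_cat /= => /eqP.
  rewrite eq_sym -[1%N]/(0 + 1)%N eqn_leq => /andP[+ _]; rewrite leqNgt => /negP; apply.
  by rewrite -addn1 leq_add ?degree_gt0 // addn1 ltnS degree_gt0.
elim: t t' => [x|t1 IH1 t2 IH2] [y|t1' t2'] l l' //.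
- by case=> ->.
- by move=> /leafN.
- by move=> /esym/leafN.
move=> E; have [_ M] := lyndon_suffix l; have [_ M'] := lyndon_suffix l'.
have [_ le1] := M _ _ E (fol_neq0 _) (fol_neq0 _).
have [_ le2] := M' _ _ (esym E) (fol_neq0 _) (fol_neq0 _).
have E2 : fol t2 = fol t2'.
  by apply/eqP/negPn/negP => /lex_total; rewrite (negPf le1) (negPf le2).
move: E => /= E; have /eqP := E; rewrite eqseq_cat; last first.
  by have /(congr1 size) := E; rewrite !size_cat E2 => /eqP; rewrite eqn_add2r => /eqP.
move=> /andP[/eqP E1 _]; case/and4P: l => l1 l2 _ _; case/and4P: l' => l1' l2' _ _.
by rewrite (IH1 t1') // (IH2 t2').
Qed.

(** * Brackets of Lyndon trees span each weight *)

Section Spanning.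
Variables (G : groupType) (a : bool -> G).

Fixpoint br (t : tree) : G :=
  match t with Leaf x => a x | Node t1 t2 => [~ br t1, br t2] end.

Lemma br_lc t n : degree t = n.+1 -> lc n (br t).
Proof.
elim: t n => [x|t1 IH1 t2 IH2] n /=; first by case: n.
rewrite degreeN; move: (degree_gt0 t1) (degree_gt0 t2).
case E1: (degree t1) => [//|i] _; case E2: (degree t2) => [//|j] _.
by rewrite addSn addnS => -[<-]; apply: lc_comm; [exact: IH1 | exact: IH2].
Qed.

(** Including [lc n], that is gamma_(n+1), makes membership a statement modulo higher weights. [P]
    carries the upper bounds on words needed by the induction in [br_comm_span]. *)
Definition span (P : tree -> Prop) n : set G := generated
  [set z | (exists t, [/\ lyndon t, degree t = n, P t & z = br t]) \/ lc n z].

Lemma span_subgroup P n : subgroup (span P n).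
Proof. exact: generated_subgroup. Qed.

Lemma lc_span P n : @lc G n `<=` span P n.
Proof. by move=> z zn; apply: generated_in; right. Qed.

Lemma br_span (P : tree -> Prop) n t :
  lyndon t -> degree t = n -> P t -> span P n (br t).
Proof. by move=> *; apply: generated_in; left; exists t. Qed.

Lemma span_min (P : tree -> Prop) n (S : set G) : subgroup S -> @lc G n `<=` S ->
  (forall t, lyndon t -> degree t = n -> P t -> S (br t)) -> span P n `<=` S.
Proof.
move=> sS nS H; apply: generated_sub => // z [[t [lt dt Pt ->]]|/nS //].
exact: H.
Qed.

Lemma span_mono (P Q : tree -> Prop) n :
  (forall t, P t -> Q t) -> span P n `<=` span Q n.
Proof.
move=> PQ; apply: span_min; [exact: span_subgroup | exact: lc_span |].
by move=> t lt dt /PQ; apply: br_span.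
Qed.

(** Bracketing with [u] is additive up to a conjugation that is trivial modulo the next term.
    Membership in [lc n] is carried through the induction because it bounds the effect of that
    conjugation. *)
Lemma span_comm P i n (S : set G) u z : subgroup S ->
  @lc G (i + n.+1).+1 `<=` S -> lc i u ->
  (forall t, lyndon t -> degree t = n.+1 -> P t -> S [~ u, br t]) ->
  span P n.+1 z -> S [~ u, z].
Proof.
move=> sS nS ui H; have [S1 SM SV] := sS.
suff sub : span P n.+1 `<=` [set z | lc n z /\ S [~ u, z]] by move=> /sub[].
have conjS g y : lc n y -> S [~ u, y] -> S ([~ u, y] ^ g).
  move=> yn; have e : eqm (i + n.+1).+1 [~ u, y] ([~ u, y] ^ g).
    by apply: eqm_conj; rewrite addnS; apply/lc_commS/lc_comm.
  by rewrite (subgroup_eqm sS nS e).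
apply: span_min.
- split=> [|x y [xn Sx] [yn Sy]|x [xn Sx]].
  + by split; [exact: lc1 | rewrite commg1].
  + split; first exact: lcM.
    by rewrite commg_mulr; apply: SM => //; apply: conjS.
  + by split; [exact: lcV | rewrite commg_invr; apply/SV/conjS].
- by move=> y yn; split; [exact: lcS | apply/nS/lc_comm].
- by move=> t lt dt Pt; split; [exact: br_lc | exact: H].
Qed.

(* Induction on the total degree, then on the larger of the two words: when
   [Node t t'] is not a Lyndon tree, [t] is a node and the Jacobi identity
   leads to brackets of trees with words smaller than [fol t']. *)
Lemma br_comm_span w t t' : lyndon t -> lyndon t' ->
  ~~ lex w (fol t) -> ~~ lex w (fol t') ->
  span (fun s => lex (fol s) w) (degree t + degree t') [~ br t, br t'].
Proof.
have [m] := ubnP (degree t + degree t').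
elim: m t t' w => // m IHm t t' w; rewrite ltnS => le_m.
(* The inner induction is on a bound [k] for the codes of both words, which have length at most
   [m]. *)
have [k kt kt'] : exists2 k, (lex_code m (fol t) < k)%N & (lex_code m (fol t') < k)%N.
  exists (maxn (lex_code m (fol t)) (lex_code m (fol t'))).+1; rewrite ltnS.
    exact: leq_maxl.
  exact: leq_maxr.
elim: k t t' kt kt' le_m => // k IHk t t' kt kt' le_m lt lt' wt wt'.
wlog ltt : t t' kt kt' le_m lt lt' wt wt' / lex (fol t) (fol t').
  move=> H; have [->|neq] := eqVneq t t'.
    by rewrite commgg; case: (span_subgroup (fun s => lex (fol s) w) (degree t' + degree t')).
  have /lex_total/orP[] : fol t != fol t'.
    by apply: contraNneq neq => /(fol_inj lt lt') ->.
    by apply: H.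
  move=> ltt; rewrite addnC in le_m *.
  by apply: (subgroup_commC (span_subgroup _ _)); apply: H.
have node : lyndon (Node t t') ->
    span (fun s => lex (fol s) w) (degree t + degree t') [~ br t, br t'].
  move=> l; rewrite -degreeN -[[~ _, _]]/(br (Node t t')); apply: br_span => //.
  exact: lex_transN (lyndon_lt l) wt'.
case: t kt le_m lt wt ltt node => [x|t1 t2] kt le_m lt wt ltt node.
  by apply: node; apply/and4P; split.
have [std|/negPn t2t'] := boolP (~~ lex (fol t2) (fol t')).
  by apply: node; apply/and4P; split.
case/and4P: (lt) => l1 l2 l12 _.
have lt1 : lex (fol t1) (fol t') by apply: lexN_trans ltt; exact: lex_prefix.
set S := span _ _; have sS : subgroup S by exact: span_subgroup.
have sz s : degree s <= m -> size (fol s) <= m by [].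
have d1 := degree_gt0 t1; have d2 := degree_gt0 t2; have d' := degree_gt0 t'.
rewrite degreeN in le_m.
have IH s s' : lyndon s -> lyndon s' -> (degree s + degree s' <= m)%N ->
    lex (fol s) (fol t') -> lex (fol s') (fol t') ->
    span (fun s => lex (fol s) w) (degree s + degree s') [~ br s, br s'].
  move=> ls ls' dm st st'.
  have w_le r : lex (fol r) (fol t') -> ~~ lex w (fol r).
    by move=> rt; apply/negP => /lex_trans/(_ rt); rewrite (negPf wt').
  have c_lt r : degree r <= m -> lex (fol r) (fol t') -> (lex_code m (fol r) < k)%N.
    move=> dr rt; rewrite -ltnS; apply: leq_ltn_trans kt'; apply: lex_code_lt => //.
    by apply: leq_trans le_m; apply: leq_addl.
  apply: IHk => //; try exact: w_le; apply: c_lt => //.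
    by apply: leq_trans dm; apply: leq_addr.
  by apply: leq_trans dm; apply: leq_addl.
have pos s : exists n, degree s = n.+1.
  by case: (degree s) (degree_gt0 s) => // n; exists n.
have [n1 e1] := pos t1; have [n2 e2] := pos t2; have [n' e'] := pos t'.
have nS n : n = (degree (Node t1 t2) + degree t')%N -> @lc G n `<=` S.
  by move=> ->; exact: lc_span.
(* The inner brackets [[t1, t']] and [[t2, t']] have smaller total degree, so the outer induction,
   with bound [fol t'], expands them into trees below [fol t']. The remaining factors [t2] and [t1]
   are also below [fol t'], so the inner induction applies to the resulting brackets. *)
apply: (@subgroup_Jacobi G n1 n2 n') => //; try exact: br_lc.
- by apply: nS; rewrite degreeN e1 e2 e' !addSn !addnS.
- apply: (subgroup_commC sS).
  apply: (@span_comm (fun s => lex (fol s) (fol t')) n2 (n1 + n').+1) => //.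
  + by apply: nS; rewrite degreeN e1 e2 e' !addSn !addnS (addnCA n2) addnA.
  + exact: br_lc.
  + move=> s ls ds st; rewrite /S degreeN (addnC (degree t1)) -addnA.
    have -> : (degree t1 + degree t')%N = degree s by rewrite ds e1 e' addSn addnS.
    apply: IH => //; rewrite ds.
    by apply: leq_trans le_m; rewrite e1 e2 e' !addSn !addnS (addnCA n2) addnA.
  + rewrite -addnS -addSn -e1 -e'; apply: IHm => //; last by rewrite lexxx.
      by apply: leq_trans le_m; rewrite ltn_add2r -[X in (X < _)%N]addn0 ltn_add2l.
    by apply/negP => /lex_trans/(_ lt1); rewrite lexxx.
- apply: (@span_comm (fun s => lex (fol s) (fol t')) n1 (n2 + n').+1) => //.
  + by apply: nS; rewrite degreeN e1 e2 e' !addSn !addnS addnA.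
  + exact: br_lc.
  + move=> s ls ds st; rewrite /S degreeN -addnA.
    have -> : (degree t2 + degree t')%N = degree s by rewrite ds e2 e' addSn addnS.
    apply: IH => //; rewrite ds.
    by apply: leq_trans le_m; rewrite e1 e2 e' !addSn !addnS addnA.
  + rewrite -addnS -addSn -e2 -e'; apply: IHm => //; last by rewrite lexxx.
      by apply: leq_trans le_m; rewrite ltn_add2r -[X in (X < _)%N]add0n ltn_add2r.
    by apply/negP => /lex_trans/(_ t2t'); rewrite lexxx.
Qed.

Lemma lc_sub_span n : (forall g : G, exists u, g = eval a u) ->
  @lc G n `<=` span xpredT n.+1.
Proof.
move=> gen; have gen1 g : span xpredT 1 g.
  have [u ->] := gen g; have [S1 SM SV] := span_subgroup xpredT 1.
  elim: u => [|[x b] u IHu] //=; apply: SM => //.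
  have Sx : span xpredT 1 (a x) by exact: (@br_span xpredT 1 (Leaf x)).
  by case: b => //=; apply: SV.
elim: n => [|n IHn]; first by move=> g _; exact: gen1.
apply: generated_sub => [|_ [x [y [xn ->]]]]; first exact: span_subgroup.
have sS := span_subgroup xpredT n.+2.
apply: (span_comm (P := xpredT) (n := 0) (i := n) sS) => //.
  by rewrite addn1; exact: lc_span.
move=> t lt dt _; apply: (subgroup_commC sS).
apply: (span_comm (P := xpredT) (n := n) (i := 0) sS) => //; last exact: IHn.
  exact: lc_span.
move=> s ls ds _; rewrite -[n.+2]/(1 + n.+1)%N -dt -ds.
have [ts|/lex_total] := eqVneq (fol t) (fol s); last case/orP => ts.
- by rewrite (fol_inj lt ls ts) commgg; case: (span_subgroup xpredT (degree s + degree s)).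
- apply: (@span_mono (fun r => lex (fol r) (fol s))) => //.
  apply: br_comm_span => //; last by rewrite lexxx.
  by apply/negP => /lex_trans/(_ ts); rewrite lexxx.
- apply: (@span_mono (fun r => lex (fol r) (fol t))) => //.
  apply: br_comm_span => //; first by rewrite lexxx.
  by apply/negP => /lex_trans/(_ ts); rewrite lexxx.
Qed.

End Spanning.


(** * Magnus series *)

Section MagnusSeries.
Import GRing.Theory.
Local Open Scope ring_scope.

(* Noncommutative power series in two variables, as families of coefficients;
   the product is the Cauchy product, computed letter by letter. *)
Definition series := seq bool -> int.
Implicit Types (f g h : series) (w : seq bool).

Fixpoint mulS f g w : int :=
  match w with
  | [::] => f [::] * g [::]
  | x :: w' => f [::] * g w + mulS (fun v => f (x :: v)) g w'
  end.

Definition oneS : series := fun w => (w == [::])%:R.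

Lemma eq_mulS f f' g g' w : f =1 f' -> g =1 g' -> mulS f g w = mulS f' g' w.
Proof.
move=> ff gg; elim: w f f' ff => [|x w IHw] f f' ff /=; rewrite ff gg //.
by congr (_ + _); apply: IHw.
Qed.

Lemma mulS_linl c f f' g w :
  mulS (fun v => c * f v + f' v) g w = c * mulS f g w + mulS f' g w.
Proof.
elim: w f f' => [|x w IHw] f f' /=; first by ring.
by rewrite IHw; ring.
Qed.

Lemma mulS_linr c f g g' w :
  mulS f (fun v => c * g v + g' v) w = c * mulS f g w + mulS f g' w.
Proof. by elim: w f => [|x w IHw] f /=; rewrite ?IHw; ring. Qed.

Lemma mulSA f g h : mulS (mulS f g) h = mulS f (mulS g h).
Proof.
apply/funext => w; elim: w f => [|x w IHw] f /=; first by rewrite mulrA.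
by rewrite mulS_linl IHw; ring.
Qed.

Lemma mulS0l g w : mulS (fun=> 0) g w = 0.
Proof. by elim: w => [|x w IHw] /=; rewrite ?IHw mul0r. Qed.

Lemma mulS1l f : mulS oneS f = f.
Proof.
apply/funext => -[|x w] /=; rewrite /oneS /= ?mul1r //.
by rewrite mulS0l addr0.
Qed.

Lemma mulS1r f : mulS f oneS = f.
Proof.
apply/funext => w; elim: w f => [|x w IHw] f /=; rewrite /oneS /= ?mulr1 //.
by rewrite mulr0 add0r IHw.
Qed.

(** Of all the ways to cut [w] in two, only the cut at position [i] can leave both factors nonzero,
    and below length [i + j] none does. *)
Lemma mulS_low i j f g w :
  (forall v, (size v < i)%N -> f v = 0) -> (forall v, (size v < j)%N -> g v = 0) ->
  ((size w < i + j)%N -> mulS f g w = 0) /\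
  (size w = (i + j)%N -> mulS f g w = f (take i w) * g (drop i w)).
Proof.
move=> + gj; elim: w i f => [|x w IHw] i f fi /=.
  split=> [|_]; last by case: (i).
  by case: i fi => [_ j0|i fi _]; [rewrite gj ?mulr0 | rewrite fi ?mul0r].
case: i fi => [|i] fi.
  have [IH0 _] := IHw 0%N (fun v => f (x :: v)) (fun v (H : (size v < 0)%N) => ltac:(done)).
  split=> [wj|[] wj]; rewrite IH0 ?addr0 //.
  - by rewrite gj ?mulr0.
  - exact: ltn_trans wj.
  - by rewrite -wj.
have [|IH1 IH2] := IHw i (fun v => f (x :: v)); first by move=> v vi; apply: fi.
rewrite fi // mul0r add0r addSn /=; split=> [|[]].
  exact: IH1.
exact: IH2.
Qed.

(** The series 1 - x + x^2 - ..., inverse to 1 + x. *)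
Definition geninv (x : bool) : series :=
  fun w => if all (pred1 x) w then (-1) ^+ size w else 0.
Definition genS (x : bool) : series := fun w => ((w == [::]) || (w == [:: x]))%:R.

Lemma genSV x : mulS (genS x) (geninv x) = oneS.
Proof.
apply/funext => -[|y w]; rewrite /genS /geninv /oneS /= ?mulr1 //.
have -> : mulS (fun v => ((y :: v == [:: x]))%:R)
    (fun w => if all (pred1 x) w then (-1) ^+ size w else 0) w =
  (y == x)%:R * (if all (pred1 x) w then (-1) ^+ size w else 0).
  under eq_mulS do [rewrite eqseq_cons -mulnb natrM|over].
  have := mulS_linl (y == x)%:R oneS (fun=> 0) (geninv x) w.
  rewrite mulS1l mulS0l addr0 => <-; apply: eq_mulS => // v.
  by rewrite addr0.
by case: (y == x) => /=; rewrite ?mul0r ?addr0 ?mulr0 // exprS; case: ifP => _; ring.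
Qed.

Lemma genVS x : mulS (geninv x) (genS x) = oneS.
Proof.
apply/funext; elim=> [|y w IHw] /=; rewrite /oneS /=; first by rewrite /genS /geninv /= mulr1.
have -> : mulS (fun v => geninv x (y :: v)) (genS x) w =
    - (y == x)%:R * mulS (geninv x) (genS x) w.
  have := mulS_linl (- (y == x)%:R) (geninv x) (fun=> 0) (genS x) w.
  rewrite mulS0l addr0 => <-; apply: eq_mulS => // v.
  by rewrite addr0 /geninv /=; case: (y == x) => /=; rewrite ?oppr0 ?mul0r // exprS; case: ifP => _; ring.
by rewrite IHw /geninv /genS /oneS /= eqseq_cons /=; case: (y == x); case: (w == [::]) => /=; ring.
Qed.

(** The inverse is stored instead of computed by recursion; being unique, it does not affect
    equality ([useries_eq]). *)
Record useries := USeries {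
  coef : series;
  coefV : series;
  coef_nil : coef [::] = 1;
  coef_mulV : mulS coef coefV = oneS;
  coef_Vmul : mulS coefV coef = oneS }.

HB.instance Definition _ := gen_eqMixin useries.
HB.instance Definition _ := gen_choiceMixin useries.

Lemma useries_eq (u v : useries) : coef u =1 coef v -> u = v.
Proof.
move=> /funext uv; have VV : coefV u = coefV v.
  rewrite -[LHS]mulS1r -(coef_mulV v) -uv -mulSA coef_Vmul mulS1l //.
case: u v uv VV => [u u' u0 uu' u'u] [v v' v0 vv' v'v] /= uv VV.
subst v v'; congr USeries; exact: Prop_irrelevance.
Qed.

Definition umul (u v : useries) : useries.
exists (mulS (coef u) (coef v)) (mulS (coefV v) (coefV u)).
- by rewrite /= !coef_nil mulr1.
- by rewrite mulSA -(mulSA (coef v)) coef_mulV mulS1l coef_mulV.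
- by rewrite mulSA -(mulSA _ (coef u)) coef_Vmul mulS1l coef_Vmul.
Defined.

Definition uone : useries.
by exists oneS oneS => //; exact: mulS1l.
Defined.

Definition uinv (u : useries) : useries.
exists (coefV u) (coef u); [|exact: coef_Vmul|exact: coef_mulV].
have := congr1 (fun f => f [::]) (coef_mulV u).
by rewrite /= coef_nil mul1r.
Defined.

Fact umulA : associative umul.
Proof. by move=> u v t; apply: useries_eq => w /=; rewrite mulSA. Qed.
Fact umul1 : left_id uone umul.
Proof. by move=> u; apply: useries_eq => w /=; rewrite mulS1l. Qed.
Fact umul1r : right_id uone umul.
Proof. by move=> u; apply: useries_eq => w /=; rewrite mulS1r. Qed.
Fact umulV : left_inverse uone uinv umul.
Proof. by move=> u; apply: useries_eq => w /=; rewrite coef_Vmul. Qed.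
Fact umulVr : right_inverse uone uinv umul.
Proof. by move=> u; apply: useries_eq => w /=; rewrite coef_mulV. Qed.

HB.instance Definition _ := isGroup.Build useries umulA umul1 umul1r umulV umulVr.

Definition ugen (x : bool) : useries.
exists (genS x) (geninv x); [by []|exact: genSV|exact: genVS].
Defined.

End MagnusSeries.

(** * Orders and leading terms of Magnus expansions *)

Section LeadingTerms.
Import GRing.Theory Num.Theory.
Local Open Scope ring_scope.
Local Open Scope group_scope.
Implicit Types (u v : useries) (w : seq bool).

Definition uord n u : Prop := forall w, (0 < size w < n)%N -> coef u w = 0.

Lemma uord1 u : uord 1 u.
Proof. by move=> [|x w]. Qed.

Lemma uord_one n : uord n 1.
Proof. by move=> [|x w]. Qed.

(** This is [u - 1], in the form that [mulS_linl] and [mulS_linr] expand. *)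
Let hat u : series := fun w => (-1) * oneS w + coef u w.

Let hat_nil u : hat u [::] = 0.
Proof. by rewrite /hat /oneS coef_nil mulN1r addNr. Qed.

Let hat_pos u w : (0 < size w)%N -> hat u w = coef u w.
Proof. by case: w => //= x w _; rewrite /hat /oneS /= mulr0 add0r. Qed.

Let hat_low n u w : uord n u -> (size w < n)%N -> hat u w = 0.
Proof.
by case: w => [|x w] un wn; rewrite ?hat_nil // hat_pos // un.
Qed.

Lemma coefM_hat u v w : (0 < size w)%N ->
  coef (u * v)%g w = coef u w + coef v w + mulS (hat u) (hat v) w.
Proof.
move=> w0; rewrite mulS_linl mulS1l mulS_linr mulS1r hat_pos //=; ring.
Qed.

Lemma coefM_low i j u v w : uord i u -> uord j v -> (0 < size w < i + j)%N ->
  coef (u * v)%g w = coef u w + coef v w.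
Proof.
move=> ui vj /andP[w0 wij]; rewrite coefM_hat //.
have [-> //] := mulS_low w (fun w => hat_low ui) (fun w => hat_low vj).
by rewrite addr0.
Qed.

Lemma coefM_eq i j u v w : uord i u -> uord j v -> (0 < i)%N -> (0 < j)%N ->
  size w = (i + j)%N ->
  coef (u * v)%g w = coef u w + coef v w + (coef u (take i w) * coef v (drop i w))%R.
Proof.
move=> ui vj i0 j0 wij; have ilt : (i < size w)%N by rewrite wij -[X in (X < _)%N]addn0 ltn_add2l.
rewrite coefM_hat ?(leq_trans _ ilt) //.
have [_ -> //] := mulS_low w (fun w => hat_low ui) (fun w => hat_low vj).
rewrite !hat_pos // ?size_drop ?subn_gt0 //.
by rewrite size_takel // ltnW.
Qed.

Lemma uordM n u v : uord n u -> uord n v -> uord n (u * v)%g.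
Proof.
move=> un vn w /andP[w0 wn]; rewrite (coefM_low un vn) ?w0 ?ltn_addr //.
by rewrite un ?vn ?w0 ?addr0.
Qed.

(** If the inverse is known to have order [m], comparing coefficients in u u^-1 = 1 gives its
    coefficients up to length [m]. These vanish below [n], so its order can be raised step by step
    to [n]. *)
Lemma coefV_low n u w : uord n u -> uord n u^-1%g /\
  ((0 < size w <= n)%N -> coef u^-1%g w = - coef u w).
Proof.
move=> un; have E m w' : uord m u^-1%g -> (m <= n)%N -> (0 < size w' <= m)%N ->
    coef u^-1%g w' = - coef u w'.
  move=> um mn /andP[w0 wm]; have := coefM_low un um (w := w').
  rewrite w0 mulgV; case: m {um} wm mn => [|m] wm mn.
    by move: wm; rewrite leqNgt w0.
  have -> : (size w' < n + m.+1)%N.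
    by apply: leq_ltn_trans wm _; rewrite -[X in (X < _)%N]add0n ltn_add2r (leq_trans _ mn).
  move=> /(_ erefl) /esym/eqP; rewrite [X in _ == X](_ : _ = 0).
    by rewrite addrC addr_eq0 => /eqP.
  by case: w' w0 {wm}.
suff ordV : uord n u^-1%g by split=> // wn; apply: E ordV _ _.
suff H m : (m <= n)%N -> uord m u^-1%g by exact: H.
elim: m => [_ [|]//|m IHm mn w' /andP[w0]]; rewrite ltnS => wm.
rewrite (E m) ?w0 //; [|exact/IHm/ltnW|exact: ltnW].
by rewrite un ?oppr0 // w0 (leq_ltn_trans wm).
Qed.

Lemma uordV n u : uord n u -> uord n u^-1%g.
Proof. by case/(coefV_low [::]). Qed.

Lemma coefX_low n u k w : uord n u -> (0 < size w <= n)%N ->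
  coef (u ^+ k)%g w = coef u w *+ k.
Proof.
move=> un /andP[w0 wn]; have ordX m : uord n (u ^+ m)%g.
  by elim: m => [|m IHm]; [exact: uord_one | rewrite expgS; exact: uordM].
elim: k => [|k IHk]; first by case: (w) w0.
rewrite expgS (coefM_low un (ordX k)) ?IHk ?mulrS // w0.
rewrite (leq_ltn_trans wn) // -[X in (X < _)%N]addn0 ltn_add2l.
by case: (n) wn => //; rewrite leqNgt w0.
Qed.

(** In uv = vu [u, v], once the commutator has order [m] its coefficients up to length [m] are
    differences of those of uv and vu. They vanish below [i + j], which raises the order one step at
    a time. *)
Lemma coefR i j u v w : uord i u -> uord j v -> (0 < i)%N -> (0 < j)%N ->
  (0 < size w <= i + j)%N ->
  coef [~ u, v] w = coef (u * v)%g w - coef (v * u)%g w.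
Proof.
move=> ui vj i0 j0; set h := [~ u, v].
have E m w' : uord m h -> (0 < size w' <= m)%N ->
    coef h w' = coef (u * v)%g w' - coef (v * u)%g w'.
  move=> hm /andP[w0 wm]; rewrite (commgC u v) -/h.
  rewrite (coefM_low (uord1 (v * u)%g) hm) ?w0 ?add1n //.
  by rewrite addrC addKr.
suff H m : (m <= i + j)%N -> uord m h by apply: E; exact: H.
elim: m => [_ [|]//|m IHm mn w' /andP[w0]]; rewrite ltnS => wm.
have wij : (0 < size w' < i + j)%N by rewrite w0 (leq_ltn_trans wm).
rewrite (E m) ?w0 //; last exact/IHm/ltnW.
rewrite (coefM_low ui vj) // (coefM_low vj ui) 1?addnC //.
by rewrite [X in _ - X]addrC subrr.
Qed.

Lemma uordR i j u v : uord i u -> uord j v -> (0 < i)%N -> (0 < j)%N ->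
  uord (i + j) [~ u, v].
Proof.
move=> ui vj i0 j0 w /andP[w0 wij].
rewrite (coefR ui vj) ?w0 //; last exact: ltnW.
rewrite (coefM_low ui vj) ?w0 //.
by rewrite (coefM_low vj ui) ?w0 1?addnC // [X in _ - X]addrC subrr.
Qed.

Lemma lc_uord n u : lc n u -> uord n.+1 u.
Proof.
elim: n u => [u _|n IHn u]; first exact: uord1.
elim=> [_ [x [y [xn ->]]]||x y _ ? _ ?|x _ ?].
- by rewrite -addn1; apply: uordR => //; [exact: IHn | exact: uord1].
- exact: uord_one.
- exact: uordM.
- exact: uordV.
Qed.

Lemma eqm_coef n u v w : eqm n u v -> (size w <= n)%N -> coef u w = coef v w.
Proof.
case: w => [|x w]; first by rewrite !coef_nil.
move=> /eqmP[h /lc_uord hn ->] wn.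
by rewrite (coefM_low (@uord1 u) hn) ?hn ?addr0 //= ltnS // (leq_trans wn).
Qed.

Local Notation ubr := (br ugen).

Lemma br_uord t : uord (degree t) (ubr t).
Proof.
elim: t => [x|t1 IH1 t2 IH2]; first exact: uord1.
by rewrite degreeN; apply: uordR => //; exact: degree_gt0.
Qed.

Lemma coef_br t1 t2 w : size w = degree (Node t1 t2) ->
  coef (ubr (Node t1 t2)) w =
    (coef (ubr t1) (take (degree t1) w) * coef (ubr t2) (drop (degree t1) w) -
    coef (ubr t2) (take (degree t2) w) * coef (ubr t1) (drop (degree t2) w))%R.
Proof.
move=> dw; have [d1 d2] := (degree_gt0 t1, degree_gt0 t2).
rewrite degreeN in dw.
rewrite -[ubr (Node t1 t2)]/[~ ubr t1, ubr t2] (coefR (@br_uord t1) (@br_uord t2)) ?dw ?leqnn ?addn_gt0 ?d1 //.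
rewrite (coefM_eq (@br_uord t1) (@br_uord t2)) //.
rewrite (coefM_eq (@br_uord t2) (@br_uord t1)) // 1?addnC //.
ring.
Qed.

(* [br t] is [fol t] plus lexicographically larger words. *)
Lemma coef_br_lyndon t : lyndon t ->
  coef (ubr t) (fol t) = 1%R /\
  (forall w, size w = degree t -> coef (ubr t) w != 0 -> ~~ lex w (fol t)).
Proof.
elim: t => [x _|t1 IH1 t2 IH2 l].
  split=> [|[|y [|? ?]]] //=; first by rewrite /genS eqxx.
  by case: x y => [] [].
have [l1 l2 _ _] := and4P l; have ltv := lyndon_lt l.
have [[L1 S1] [L2 S2]] := (IH1 l1, IH2 l2).
split=> [|w dw].
  rewrite coef_br // {1 2}/fol -/fol take_size_cat // drop_size_cat // L1 L2 mulr1.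
  (* The subtracted term vanishes: a prefix of the Lyndon word [fol t1 ++ fol t2] is below [fol t2],
     whereas [br t2] is supported on words that are not. *)
  have [-> | nz] := eqVneq (coef (ubr t2) (take (degree t2) (fol (Node t1 t2)))) 0%R.
    by rewrite mul0r subr0.
  have st : size (take (degree t2) (fol (Node t1 t2))) = degree t2.
    by rewrite size_takel // -/(degree (Node t1 t2)) degreeN leq_addl.
  have /negP[] := S2 _ st nz; apply: lexN_trans ltv.
  by rewrite -{1}[fol t1 ++ fol t2](cat_take_drop (degree t2)) lex_prefix.
have st i : (i <= degree (Node t1 t2))%N -> size (take i w) = i.
  by move=> ile; rewrite size_takel // dw.
rewrite coef_br //; apply: contraNN => ltw.
have -> : coef (ubr t2) (take (degree t2) w) = 0%R.
  apply: contraTeq ltw => /(S2 _ (st _ _)); rewrite degreeN leq_addl => /(_ isT) ge2.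
  apply/negP => ltw; move/negP: ge2; apply.
  apply: (lexN_trans _ (lex_trans ltw ltv)).
  by rewrite -{1}[w](cat_take_drop (degree t2)) lex_prefix.
rewrite mul0r subr0.
have s1 : size (take (degree t1) w) = degree t1 by rewrite st // degreeN leq_addr.
have s2 : size (drop (degree t1) w) = degree t2 by rewrite size_drop dw degreeN addKn.
have [->|n1] := eqVneq (coef (ubr t1) (take (degree t1) w)) 0%R; first by rewrite mul0r.
have [->|n2] := eqVneq (coef (ubr t2) (drop (degree t1) w)) 0%R; first by rewrite mulr0.
have ge1 := S1 _ s1 n1; have ge2 := S2 _ s2 n2.
move: ltw; rewrite -{1}[w](cat_take_drop (degree t1)) /=.
have [->|/lex_total] := eqVneq (take (degree t1) w) (fol t1).
  by rewrite lex_catl (negPf ge2).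
rewrite (negPf ge1) /= => gt1 lt1.
have := lex_trans lt1 (lex_cat2 (fol t2) (drop (degree t1) w) (esym s1) gt1).
by rewrite lexxx.
Qed.

End LeadingTerms.


Lemma lc_center (G : groupType) n (x y : G) :
  nilpotent_class_le n.+1 G -> lc n x -> commute x y.
Proof. by move=> Gn xn; apply/commgP/eqP/Gn/lc_commS. Qed.

(** * Free nilpotent groups have torsion-free last term *)

Section TorsionFree.
Import GRing.Theory Num.Theory.

Local Notation cbr t w := (coef (br ugen t) w).

(** Lists serve as multisets, that is, as nonnegative exponents; integral exponents are represented
    by pairs of lists. *)
Definition lyndons n (s : seq tree) : Prop :=
  forall t, t \in s -> lyndon t /\ degree t = n.+1.

Lemma lyndons_cons n t s : lyndons n (t :: s) ->
  [/\ lyndon t, degree t = n.+1 & lyndons n s].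
Proof.
move=> ls; have [lt dt] := ls t (mem_head _ _); split=> // r rs.
by apply: ls; rewrite inE rs orbT.
Qed.

Lemma lyndons_cat n s1 s2 : lyndons n s1 -> lyndons n s2 -> lyndons n (s1 ++ s2).
Proof. by move=> l1 l2 t; rewrite mem_cat => /orP[/l1|/l2]. Qed.

Lemma lc_prod_br n (G : groupType) (a : bool -> G) s :
  lyndons n s -> lc n (\prod_(t <- s) br a t).
Proof.
elim: s => [_|t s IHs /lyndons_cons[_ dt /IHs]]; first by rewrite big_nil; exact: lc1.
by rewrite big_cons => sn; apply: lcM sn; exact: br_lc.
Qed.

Lemma coef_prod_br n s w : lyndons n s -> (0 < size w <= n.+1)%N ->
  coef (\prod_(t <- s) br ugen t) w = (\sum_(t <- s) cbr t w)%R.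
Proof.
move=> ls /andP[w0 wn].
elim: s ls => [_|t s IHs /lyndons_cons[lt dt ls]].
  by rewrite !big_nil; case: (w) w0.
have ut : uord n.+1 (br ugen t) by rewrite -dt; exact: br_uord.
rewrite !big_cons (coefM_low ut (lc_uord (lc_prod_br _ ls))) ?IHs //.
by rewrite w0 (leq_ltn_trans wn) // addSn ltnS addnS ltnS leq_addr.
Qed.

Lemma lex_min (s : seq tree) : s != [::] ->
  exists2 t, t \in s & forall r, r \in s -> ~~ lex (fol r) (fol t).
Proof.
elim: s => // t s IHs _; have [->|/IHs[r rs rmin]] := eqVneq s [::].
  by exists t; rewrite ?mem_head // => r; rewrite inE => /eqP->; rewrite lexxx.
have [lt|ge] := boolP (lex (fol t) (fol r)).
  exists t; rewrite ?mem_head // => q; rewrite inE => /predU1P[->|/rmin].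
    by rewrite lexxx.
  by apply: contraNN => /lex_trans/(_ lt).
exists r; first by rewrite inE rs orbT.
by move=> q; rewrite inE => /predU1P[->|/rmin].
Qed.

(** A tree with a larger word contributes nothing at [fol t], and each copy of [t] contributes 1. *)
Lemma sum_count_min n (s : seq tree) t : lyndons n s -> lyndon t -> degree t = n.+1 ->
  (forall r, r \in s -> ~~ lex (fol r) (fol t)) ->
  (\sum_(r <- s) cbr r (fol t))%R = (count_mem t s)%:R%R.
Proof.
move=> + lt dt; elim: s => [|r s IHs]; first by rewrite big_nil.
move=> /lyndons_cons[lr dr ls] tmin; rewrite big_cons /= natrD IHs //; last first.
  by move=> q qs; apply: tmin; rewrite inE qs orbT.
congr (_ + _)%R; have [-> |rt] := eqVneq r t; first by have [] := coef_br_lyndon lt.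
apply/eqP; apply: contraNT rt => /(proj2 (coef_br_lyndon lr) _ _).
rewrite -/(degree t) dt dr => /(_ erefl) ge.
apply/eqP/(fol_inj lr lt)/eqP/negPn/negP => /lex_total.
by rewrite (negPf ge) (negPf (tmin _ (mem_head _ _))).
Qed.

Lemma prod_br_rem n (G : groupType) (a : bool -> G) t s :
  nilpotent_class_le n.+1 G -> lyndons n s -> t \in s ->
  \prod_(r <- s) br a r = br a t * \prod_(r <- rem t s) br a r.
Proof.
move=> Gn; elim: s => // r s IHs /lyndons_cons[lr dr ls].
rewrite inE big_cons /=; have [->//|_ /= ts] := eqVneq t r.
have C : commute (br a r) (br a t) by apply: lc_center Gn (br_lc a dr).
by rewrite big_cons IHs // !mulgA C.
Qed.

Lemma lyndons_rem n t s : lyndons n s -> lyndons n (rem t s).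
Proof. by move=> ls r /mem_rem/ls. Qed.

(* The brackets of the Lyndon trees of a given degree are independent, since
   their leading words are distinct. *)
Lemma prod_br_inj n (G : groupType) (a : bool -> G) s1 s2 :
  nilpotent_class_le n.+1 G -> lyndons n s1 -> lyndons n s2 ->
  (forall w, size w = n.+1 ->
     (\sum_(t <- s1) cbr t w)%R = (\sum_(t <- s2) cbr t w)%R) ->
  \prod_(t <- s1) br a t = \prod_(t <- s2) br a t.
Proof.
move=> Gn; have [m] := ubnP (size s1); elim: m s1 s2 => // m IHm s1 s2.
rewrite ltnS => sm l1 l2 E.
have [/eqP|nz] := eqVneq (s1 ++ s2) [::].
  by rewrite -size_eq0 size_cat addn_eq0 !size_eq0 => /andP[/eqP-> /eqP->].
(* At the least word present, both sums are multiplicities of [t], so [t] occurs in both lists and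
   can be struck from each. *)
have [t ts tmin] := lex_min nz.
have [lt dt] := lyndons_cat l1 l2 ts.
have tmin1 r : r \in s1 -> ~~ lex (fol r) (fol t).
  by move=> rs; apply: tmin; rewrite mem_cat rs.
have tmin2 r : r \in s2 -> ~~ lex (fol r) (fol t).
  by move=> rs; apply: tmin; rewrite mem_cat rs orbT.
have := E _ dt; rewrite !(@sum_count_min n) // => /eqP; rewrite eqr_nat => /eqP cE.
have [t1 t2] : t \in s1 /\ t \in s2.
  have mE s : (t \in s) = (0 < count_mem t s)%N by rewrite -has_count has_pred1.
  by move: ts; rewrite mem_cat !mE cE orbb.
rewrite (prod_br_rem a Gn l1 t1) (prod_br_rem a Gn l2 t2); congr (_ * _).
apply: IHm; try exact: lyndons_rem.
  by rewrite size_rem //; case: (s1) t1 sm.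
move=> w wn; have := E w wn; rewrite (big_rem _ t1) (big_rem _ t2) /=.
exact: addrI.
Qed.

Lemma span_prod n (G : groupType) (a : bool -> G) z :
  nilpotent_class_le n.+1 G -> span a xpredT n.+1 z ->
  exists s1 s2, [/\ lyndons n s1, lyndons n s2 &
    z * \prod_(t <- s1) br a t = \prod_(t <- s2) br a t].
Proof.
move=> Gn.
elim=> [x [[t [lt dt _ ->]]|/Gn->]||x y _ [s1 [s2 [l1 l2 E]]] _ [r1 [r2 [k1 k2 F]]]|
        x _ [s1 [s2 [l1 l2 E]]]].
- exists [::], [:: t]; split=> //; first by move=> r; rewrite inE => /eqP->.
  by rewrite big_nil big_seq1 mulg1.
- by exists [::], [::]; rewrite !big_nil mulg1.
- by exists [::], [::]; rewrite !big_nil mulg1.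
- exists (r1 ++ s1), (s2 ++ r2); split; try exact: lyndons_cat.
  rewrite !big_cat /= -E -F; set A := \prod_(t <- s1) _.
  set B := \prod_(t <- r1) _.
  have C : commute A (y * B) by exact: lc_center Gn (lc_prod_br a l1).
  by rewrite -!mulgA (mulgA y B) -C mulgA.
- by exists s2, s1; rewrite -E mulKg.
Qed.

Lemma br_hom (G H : groupType) (f : group_hom G H) (a : bool -> G) t :
  f (br a t) = br (f \o a) t.
Proof. by elim: t => //= t1 <- t2 <-; rewrite gmulfR. Qed.

Lemma eq_br (G : groupType) (a b : bool -> G) t : a =1 b -> br a t = br b t.
Proof. by move=> ab; elim: t => [x|t1 IH1 t2 IH2] /=; rewrite ?ab // IH1 IH2. Qed.

(** Write [p] as a quotient of two products of Lyndon brackets and let the series [f] lift its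
    Magnus image. Taking the N-th power multiplies the coefficients of [f] in degree [n.+1] by N, so
    these vanish. The two products then have equal leading coefficients, and [prod_br_inj] equates
    them in the free nilpotent group itself. *)
Lemma free_nil_torsion_free n (p : free_nil n.+1 bool) N :
  lc n p -> (0 < N)%N -> p ^+ N = 1 -> p = 1.
Proof.
move=> pn N0 pN; set W : groupType := free_nil n.+1 bool in p pn pN *.
have Wn : nilpotent_class_le n.+1 W by exact: free_nil_nilpotent.
pose g := @free_nil_gen n.+1 bool.
have [s1 [s2 [l1 l2 E]]] : exists s1 s2, [/\ lyndons n s1, lyndons n s2 &
    p * \prod_(t <- s1) br (g : bool -> W) t = \prod_(t <- s2) br (g : bool -> W) t].
  apply: span_prod => //; apply: lc_sub_span pn; exact: free_nil_evalE.
(* The group of series is not nilpotent, so [rho] lands in a quotient of it and values are lifted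
   back. *)
pose U : groupType := useries.
have Qn := @nil_quot_nilpotent U n.+1.
pose rho : group_hom W (nil_quot U n.+1) :=
  free_nil_lift Qn (fun x => nil_quot_pi n.+1 (ugen x : U)).
have rho_prod s : rho (\prod_(t <- s) br (g : bool -> W) t) =
    nil_quot_pi n.+1 (\prod_(t <- s) br (ugen : bool -> U) t).
  rewrite !gmulf_prod; apply: eq_bigr => t _; rewrite !br_hom.
  by apply: eq_br => x /=; exact: (free_nil_liftE Qn).
have [f Ef] := nil_quot_pi_surj (rho p).
have fA : eqm n.+1 (f * \prod_(t <- s1) br (ugen : bool -> U) t)
                   (\prod_(t <- s2) br (ugen : bool -> U) t).
  apply/nil_quot_pi_eqP; rewrite -rho_prod -E.
  have -> : rho (p * \prod_(t <- s1) br (g : bool -> W) t) =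
      rho p * rho (\prod_(t <- s1) br (g : bool -> W) t) by exact: gmulfM.
  by rewrite Ef rho_prod; exact: gmulfM.
have fN : eqm n.+1 (f ^+ N) 1.
  apply/nil_quot_pi_eqP; transitivity (rho (p ^+ N)).
    have -> : rho (p ^+ N) = rho p ^+ N by exact: gmulfXn.
    by rewrite Ef; exact: gmulfXn.
  by rewrite pN gmulf1; apply/esym; exact: gmulf1.
have fn : uord n.+1 f.
  apply: lc_uord; have /eqmP[h hn Eh] := eqm_sym fA.
  rewrite -[f](mulgK (\prod_(t <- s1) br (ugen : bool -> U) t)) Eh.
  by apply/lcM; [apply: lcM; [exact: lc_prod_br | exact: lcS] | apply/lcV/lc_prod_br].
have f0 w : size w = n.+1 -> coef f w = 0%R.
  move=> wn; have := eqm_coef fN (w := w); rewrite (coefX_low _ fn) wn ?leqnn //.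
  move=> /(_ erefl) Ew; have : (coef f w *+ N == 0)%R.
    by rewrite Ew; case: (w) wn.
  by rewrite mulrn_eq0 eqn0Ngt N0 => /eqP.
suff EP : \prod_(t <- s1) br (g : bool -> W) t = \prod_(t <- s2) br (g : bool -> W) t.
  by rewrite -[p](mulgK (\prod_(t <- s1) br (g : bool -> W) t)) E EP mulgV.
apply: (@prod_br_inj n) => // w wn.
have w0 : (0 < size w <= n.+1)%N by rewrite wn ltnSn.
rewrite -!(@coef_prod_br n) // -(eqm_coef fA) ?wn //.
rewrite (coefM_low fn (lc_uord (lc_prod_br _ l1))) ?f0 ?add0r // wn /=.
by rewrite addSn ltnS addnS ltnS leq_addr.
Qed.

End TorsionFree.


Arguments lower_central : simpl never.

(** * Group operations given by words *)

Definition two (T : Type) (a b : T) (z : bool) : T := if z then b else a.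

Definition ev (u : word bool) (G : groupType) (a b : G) : G := eval (two a b) u.

Lemma ev_hom (u : word bool) (G H : groupType) (f : group_hom G H) a b :
  f (ev u a b) = ev u (f a) (f b).
Proof. by rewrite /ev eval_hom; apply: eq_eval => -[]. Qed.

Definition unital d u : Prop := forall G : groupType, nilpotent_class_le d G ->
  forall a : G, ev u a 1 = a /\ ev u 1 a = a.

Definition assoc d u : Prop := forall G : groupType, nilpotent_class_le d G ->
  forall a b c : G, ev u (ev u a b) c = ev u a (ev u b c).

Definition agree n u : Prop := forall G : groupType, nilpotent_class_le n G ->
  forall a b : G, ev u a b = a * b.

Definition F2 n : groupType := free_nil n bool.
Definition gen0 n : F2 n := free_nil_gen n false.
Definition gen1 n : F2 n := free_nil_gen n true.

Section Lift2.
Variables (n : nat) (G : groupType) (Gn : nilpotent_class_le n G) (a b : G).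

Lemma lift2 : exists f : group_hom (F2 n) G,
  f (gen0 n) = a /\ f (gen1 n) = b.
Proof. by exists (free_nil_lift Gn (two a b)); rewrite /gen0 /gen1 !free_nil_liftE. Qed.

End Lift2.

Lemma agree_gen n u :
  ev u (gen0 n) (gen1 n) =
    gen0 n * gen1 n -> agree n u.
Proof.
move=> E G Gn a b; have [f [<- <-]] := lift2 Gn a b.
by rewrite -ev_hom E; exact: gmulfM.
Qed.

(** In an abelian group [ev u] is a homomorphism of the pair (a, b), which is the product of (a, 1)
    and (1, b). *)
Lemma agree1 d u : 0 < d -> unital d u -> agree 1 u.
Proof.
move=> d0 U G G1 a b.
have C (x y : G) : commute x y by apply: lc_center G1 _.
have evalM f g : eval f u * eval g u = eval (fun z : bool => f z * g z : G) u.
  elim: u {U} => [|[z c] u IHu] /=; first by rewrite mulg1.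
  rewrite -IHu !mulgA; congr (_ * _).
  rewrite -!mulgA (C (eval f u)) !mulgA; congr (_ * _).
  by case: c; rewrite //= invgM C.
have [Ua _] := U G (nilpotent_class_leW d0 G1) a.
have [_ Ub] := U G (nilpotent_class_leW d0 G1) b.
rewrite -{2}Ua -{2}Ub /ev evalM; apply: eq_eval.
by case; rewrite /= ?mul1g ?mulg1.
Qed.

Lemma eval_commute (X : Type) (G : groupType) (a : X -> G) (u v : word X) :
  (forall x y, commute (a x) (a y)) -> commute (eval a u) (eval a v).
Proof.
move=> C; have H g w : (forall x, commute g (a x)) -> commute g (eval a w).
  move=> Cg; elim: w => [|[x b] w IHw] /=; first exact: commute1.
  by apply: commuteM => //; case: b => //=; apply: commuteV.
by apply: (H) => x; apply/commute_sym/H => y; apply: C.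
Qed.

Section Correction.
Variables (n : nat) (u : word bool).
Hypothesis un : agree n.+1 u.

Definition corr (G : groupType) (a b : G) : G := locked ((a * b)^-1 * ev u a b).

Lemma evE (G : groupType) (a b : G) : ev u a b = a * b * corr a b.
Proof. by rewrite /corr -lock mulVKg. Qed.

Lemma corr_hom (G H : groupType) (f : group_hom G H) a b :
  f (corr a b) = corr (f a) (f b).
Proof. by rewrite /corr -!lock gmulfM gmulfV gmulfM ev_hom. Qed.

Lemma corr_lc (G : groupType) (a b : G) : lc n.+1 (corr a b).
Proof.
rewrite /corr -lock; suff : eqm n.+1 (a * b) (ev u a b) by [].
have E (H : groupType) : nilpotent_class_le n.+1 H -> forall h : bool -> H,
    eval h [:: (false, true); (true, true)] = eval h u.
  move=> Hn h; rewrite /= mulg1 -(un Hn (h false) (h true)).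
  by apply: eq_eval => -[].
by have := eval_lower_central E (two a b); rewrite /= mulg1.
Qed.

(** The error term of two free generators is a product of commutators, and these die when the
    generators go to commuting elements. *)
Lemma corr_commute (G : groupType) k (a b : G) : nilpotent_class_le k G ->
  commute a b -> corr a b = 1.
Proof.
move=> Gk C; have [f [fa fb]] := lift2 Gk a b.
have D p q : commute (f p) (f q).
  have [v ->] := free_nil_evalE p; have [w ->] := free_nil_evalE q.
  rewrite !eval_hom; apply: eval_commute => -[] [] /=; rewrite ?fa ?fb //.
rewrite -fa -fb -corr_hom.
have := lc_le (ltn0Sn n) (corr_lc (gen0 k) (gen1 k)).
elim=> [_ [p [q [_ ->]]]||p q _ Ep _ Eq|p _ Ep].
- by rewrite gmulfR; apply/eqP/commgP.
- exact: gmulf1.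
- by rewrite gmulfM Ep Eq mulg1.
- by rewrite gmulfV Ep invg1.
Qed.

End Correction.

(** Modulo the next term a bracket is multilinear in its leaves, each of which contributes a factor
    [k] to the exponent. *)
Lemma br_pow (G : groupType) (a b : bool -> G) k t :
  (forall z, eqm 1 (a z ^+ k) (b z)) ->
  eqm (degree t) (br a t ^+ (k ^ degree t)) (br b t).
Proof.
move=> ab; elim: t => [z|t1 IH1 t2 IH2]; first by rewrite expn1; exact: ab.
rewrite degreeN /=; case d1: (degree t1) IH1 (degree_gt0 t1) => [//|i] IH1 _.
case d2: (degree t2) IH2 (degree_gt0 t2) => [//|j] IH2 _.
have [l1 l2] := (br_lc a d1, br_lc a d2).
have lX m x e : lc m x -> lc m (x ^+ e : G).
  by move=> xm; elim: e => [|e IHe]; [exact: lc1 | rewrite expgS; exact: lcM].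
have E1 := eqm_commXl (k ^ i.+1)%N l1 l2.
have E2 := eqm_commXr (k ^ j.+1)%N (lX _ _ (k ^ i.+1)%N l1) l2.
rewrite expnD expgnA addSn addnS.
apply: eqm_trans (eqm_trans (eqmX _ E1) E2) _.
apply: (@eqm_trans _ _ [~ br b t1, br a t2 ^+ (k ^ j.+1)]).
  by rewrite -addSn; apply: eqm_comml IH1 _; exact: lX.
rewrite -[(i + j).+1]addnS; apply: eqm_commr IH2.
by apply: br_lc; rewrite -d1.
Qed.

(** * From class n + 1 to class n + 2 *)

Section Step.
Variables (n : nat) (u : word bool).
Hypotheses (n0 : 0 < n) (un : agree n.+1 u).
Local Notation c := (corr u).

Section Group.
Variables (G : groupType) (Gn : nilpotent_class_le n.+2 G).

Lemma corrC (a b x : G) : commute (c a b) x.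
Proof. exact: lc_center Gn (corr_lc un a b). Qed.

(** The error term of the free generators is a product of brackets of degree [n.+2], to which
    [br_pow] applies. With [k = 2] this is homogeneity; with [k = 1] it says that [c] depends only
    on its arguments modulo commutators. *)
Lemma corr_pow k (a b a' b' : G) : eqm 1 (a ^+ k) a' -> eqm 1 (b ^+ k) b' ->
  c a' b' = c a b ^+ (k ^ n.+2).
Proof.
move=> aa bb; have [f [fa fb]] := lift2 Gn a b; have [g [ga gb]] := lift2 Gn a' b'.
rewrite -fa -fb -ga -gb -!corr_hom.
have gen (p : F2 n.+2) : exists w, p = eval (@free_nil_gen n.+2 bool) w.
  exact: free_nil_evalE.
have := lc_sub_span gen (corr_lc un (gen0 n.+2) (gen1 n.+2)).
set p := corr u _ _.
suff sub : span (@free_nil_gen n.+2 bool) xpredT n.+2 `<=`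
    [set p : F2 n.+2 | lc n.+1 (f p) /\ g p = f p ^+ (k ^ n.+2)] by move=> /sub[].
apply: span_min.
- split; first by rewrite /= !gmulf1 expg1n; split=> //; exact: lc1.
    move=> q r [fq Eq] [fr Er] /=; rewrite !gmulfM; split; first exact: lcM.
    by rewrite Eq Er expgMn //; exact: lc_center Gn fq.
  by move=> q [fq Eq] /=; rewrite !gmulfV; split; [exact: lcV | rewrite Eq expVgn].
- move=> q qn /=; have -> : q = 1 by apply: (@free_nil_nilpotent n.+2 bool).
  by rewrite !gmulf1 expg1n; split=> //; exact: lc1.
move=> t lt dt _; rewrite /= !br_hom; split; first exact: br_lc.
have /Gn/mulg1_eq : eqm n.+2 (br (f \o @free_nil_gen n.+2 bool) t ^+ (k ^ n.+2))
    (br (g \o @free_nil_gen n.+2 bool) t).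
  have := @br_pow G (f \o @free_nil_gen n.+2 bool) (g \o @free_nil_gen n.+2 bool) k t.
  rewrite dt; apply; case=> /=.
    by rewrite -[free_nil_gen _ _]/(gen1 _) fb gb.
  by rewrite -[free_nil_gen _ _]/(gen0 _) fa ga.
by rewrite invgK.
Qed.

Lemma eq_corr (a b a' b' : G) : eqm 1 a a' -> eqm 1 b b' -> c a b = c a' b'.
Proof.
by move=> aa bb; rewrite (@corr_pow 1 a b a' b') ?exp1n ?expg1.
Qed.

(* Comes from (aa)(bb) = a((ab)b) and (ab)(ab) = a((ba)b), read for the
   operation [ev u]. *)
Lemma corr_relation (a b : G) : assoc n.+2 u ->
  c b a * c a b ^+ (2 ^ n.+2) = c a b ^+ 3.
Proof.
move=> A; pose m (x y : G) := ev u x y.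
have mA x y z : m (m x y) z = m x (m y z) by exact: A.
have mE x y : m x y = x * y * c x y by exact: evE.
have mC x y : commute x y -> m x y = x * y.
  by move=> C; rewrite mE (corr_commute un Gn) ?mulg1.
have cr (x y z w : G) : c (x * c z w) y = c x y.
  apply: eq_corr; last exact: eqm_refl.
  by apply/eqm_sym/eqm_mulr/(lc_le _ (corr_lc un z w)).
have cl (x y z w : G) : c x (y * c z w) = c x y.
  apply: eq_corr; first exact: eqm_refl.
  by apply/eqm_sym/eqm_mulr/(lc_le _ (corr_lc un z w)).
have ab : eqm 1 (a * b) (b * a).
  by rewrite commgC; apply/eqm_sym/eqm_mulr/lc_commS.
have c2 : c (a * a) (b * b) = c a b ^+ (2 ^ n.+2).
  by apply: corr_pow; exact: eqm_refl.
have E1 : a * a * (b * b) * c (a * a) (b * b) =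
    a * (a * b * b) * (c a b * c (a * b) b * c a (a * b * b)).
  rewrite -mE -(mC a a) // -(mC b b) // mA -(mA a b b) (mE (m a b)) mE (mE a b) cr.
  have -> : a * b * c a b * b = a * b * b * c a b by rewrite -!mulgA (corrC a b b).
  by rewrite !cl !mulgA.
have E2 : (a * b * c a b) * (a * b * c a b) =
    a * (b * a * b) * (c b a * c (a * b) b * c a (a * b * b)).
  rewrite -mE -mC // mA -(mA b a b) (mE (m b a)) mE (mE b a) cr.
  have -> : b * a * c b a * b = b * a * b * c b a by rewrite -!mulgA (corrC b a b).
  rewrite !cl !mulgA; congr (_ * _ * _).
    by apply: eq_corr; [exact: eqm_sym | exact: eqm_refl].
  by apply: eq_corr; [exact: eqm_refl | apply: eqmM (eqm_refl _ _); exact: eqm_sym].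
have {E1} E1 : c a b ^+ (2 ^ n.+2) = c a b * (c (a * b) b * c a (a * b * b)).
  by move: E1; rewrite c2 !mulgA -!mulgA => /mulgI/mulgI/mulgI/mulgI.
have {E2} E2 : c a b ^+ 2 = c b a * (c (a * b) b * c a (a * b * b)).
  move: E2; rewrite expg2 -(mulgA (a * b)) (mulgA (c a b)) (corrC a b (a * b)).
  by rewrite -!mulgA => /mulgI/mulgI/mulgI/mulgI.
(* Write P, Q for c(a, b), c(b, a) and K for the common factor c(ab, b) c(a, ab^2). From P^(2^(n+2))
   = P K and P^2 = Q K follows Q P^(2^(n+2)) = P Q K = P^3. *)
by rewrite E1 mulgA -(corrC a b (c b a)) -mulgA -E2 -expgS.
Qed.

End Group.

Lemma agree_step : assoc n.+2 u -> agree n.+2 u.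
Proof.
move=> A; apply: agree_gen; set x := gen0 _; set y := gen1 _.
have Wn : nilpotent_class_le n.+2 (F2 n.+2) by exact: free_nil_nilpotent.
have R1 := corr_relation Wn x y A; have R2 := corr_relation Wn y x A.
have C := corrC Wn.
have j8 : 8 <= (2 ^ n.+2)%N by rewrite -[8]/(2 ^ 3)%N leq_exp2l.
set N := (2 ^ n.+2)%N in R1 R2 j8.
have tf p k : lc n.+1 (p : F2 n.+2) -> 0 < k -> p ^+ k = 1 -> p = 1.
  exact: free_nil_torsion_free.
(* With P = [c x y] and Q = [c y x], multiplying [R1] and [R2] gives (PQ)^(N+1) = (PQ)^3. Once PQ =
   1, [R1] reads P^N = P^4. Both N - 2 and N - 4 are positive because N is at least 8. *)
have inv : c x y * c y x = 1.
  apply: (tf _ (N - 2)%N); first by apply: lcM; exact: corr_lc.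
    by rewrite subn_gt0 (leq_trans _ j8).
  apply: (@mulIg _ ((c x y * c y x) ^+ 3)); rewrite mul1g -expgnDr.
  rewrite addnBAC ?(leq_trans _ j8) // addn3 subn2 /= expgS.
  rewrite !expgMn; try exact: C.
  rewrite -R1 -R2 (C x y (c y x)) -!mulgA; congr (_ * _).
  by rewrite !mulgA; congr (_ * _); apply: commuteX.
have c1 : c x y = 1.
  apply: (tf _ (N - 4)%N); first exact: corr_lc.
    by rewrite subn_gt0 (leq_trans _ j8).
  apply: (@mulIg _ (c x y ^+ 4)); rewrite mul1g -expgnDr subnK ?(leq_trans _ j8) //.
  by rewrite expgS -R1 mulgA inv mul1g.
by rewrite (evE u x y) c1 mulg1.
Qed.

End Step.

(** * Class two *)

Section Heisenberg.
Import GRing.Theory.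
Local Open Scope ring_scope.

(* The Heisenberg group with its product twisted by the m-th power of the
   commutator. *)
Definition heis (m : int) : Type := (int * int * int)%type.
HB.instance Definition _ m := Choice.on (heis m).

Variable m : int.
Definition heis_mul (p q : heis m) : heis m :=
  (p.1.1 + q.1.1, p.1.2 + q.1.2,
   p.2 + q.2 + p.1.1 * q.1.2 + m * (p.1.1 * q.1.2 - q.1.1 * p.1.2)).
Definition heis_one : heis m := (0, 0, 0).
Definition heis_inv (p : heis m) : heis m :=
  (- p.1.1, - p.1.2, - p.2 + p.1.1 * p.1.2).

Fact heis_mulA : associative heis_mul.
Proof. by move=> [[a b] c] [[a' b'] c'] [[a'' b''] c'']; congr (_, _, _) => /=; ring. Qed.
Fact heis_mul1 : left_id heis_one heis_mul.
Proof. by move=> [[a b] c]; congr (_, _, _) => /=; ring. Qed.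
Fact heis_mul1r : right_id heis_one heis_mul.
Proof. by move=> [[a b] c]; congr (_, _, _) => /=; ring. Qed.
Fact heis_mulV : left_inverse heis_one heis_inv heis_mul.
Proof. by move=> [[a b] c]; congr (_, _, _) => /=; ring. Qed.
Fact heis_mulVr : right_inverse heis_one heis_inv heis_mul.
Proof. by move=> [[a b] c]; congr (_, _, _) => /=; ring. Qed.

HB.instance Definition _ := isGroup.Build (heis m)
  heis_mulA heis_mul1 heis_mul1r heis_mulV heis_mulVr.

Lemma heisE (p q : heis m) : (p * q)%g = heis_mul p q. Proof. by []. Qed.
Lemma heisVE (p : heis m) : (p^-1)%g = heis_inv p. Proof. by []. Qed.

(** Exchanging the arguments changes ab [a, b]^m by the factor [a, b]^(1 + 2m). *)
Lemma heis_commE (p q : heis m) :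
  [~ p, q]%g = (0, 0, (1 + 2%:Z * m) * (p.1.1 * q.1.2 - q.1.1 * p.1.2)) :> heis m.
Proof.
case: p q => [[a b] c] [[a' b'] c'].
rewrite /commg /conjg !heisE !heisVE /heis_mul /heis_inv /=.
by congr (_, _, _); ring.
Qed.

Lemma heis_expE (c : int) k : (((0, 0, c) : heis m) ^+ k)%g = (0, 0, c * k%:Z) :> heis m.
Proof.
elim: k => [|k IHk]; first by rewrite mulr0.
by rewrite expgS IHk heisE /heis_mul /=; congr (_, _, _); rewrite ?intS; ring.
Qed.

Lemma heis_nilpotent : nilpotent_class_le 2 (heis m).
Proof.
have Z (p : heis m) : lc 1 p -> p.1 = (0, 0).
  elim=> [_ [x [y [_ ->]]]||x y _ Ex _ Ey|x _ Ex] //; first by rewrite heis_commE.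
    by rewrite heisE /heis_mul /= Ex Ey /= addr0.
  by rewrite heisVE /heis_inv /= Ex /= oppr0.
move=> p; elim=> [_ [x [y [x1 ->]]]||x y _ -> _ ->|x _ ->].
- by rewrite heis_commE (Z _ x1) /= mul0r mulr0 subr0 mulr0.
- by [].
- exact: mulg1.
- exact: invg1.
Qed.

End Heisenberg.

(* The value of [w] for the operation [ev u], whose inverse is that of [G]. *)
Definition seval (u : word bool) (X : Type) (G : groupType) (a : X -> G) (w : word X) : G :=
  foldr (fun l r => ev u (if l.2 then a l.1 else (a l.1)^-1) r) 1 w.

(** The only Lyndon tree of degree two is that of [[~ x, y]], so the error term is a power of it;
    its integral exponent is [m2 - m1]. *)
Lemma agree_comm u : agree 1 u -> exists m1 m2, forall G : groupType,
  nilpotent_class_le 2 G -> forall a b : G,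
  ev u a b * [~ a, b] ^+ m1 = a * b * [~ a, b] ^+ m2.
Proof.
move=> u1; pose x := gen0 2; pose y := gen1 2.
have W2 : nilpotent_class_le 2 (F2 2) by exact: free_nil_nilpotent.
have gen (p : F2 2) : exists w, p = eval (@free_nil_gen 2 bool) w.
  exact: free_nil_evalE.
have [s1 [s2 [l1 l2 E]]] := span_prod W2 (lc_sub_span gen (corr_lc u1 x y)).
have P s : lyndons 1 s -> \prod_(t <- s) br (@free_nil_gen 2 bool : bool -> F2 2) t =
    [~ x, y] ^+ size s.
  elim: s => [_|t s IHs /lyndons_cons[lt dt ls]]; first by rewrite big_nil.
  rewrite big_cons IHs // expgS; congr (_ * _).
  have dl r : degree r = 1%N -> exists z, r = Leaf z.
    case: r => [z|r1 r2]; first by exists z.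
    rewrite degreeN => d; have := degree_gt0 r1; have := degree_gt0 r2; lia.
  case: t lt dt => [//|r1 r2] lt; rewrite degreeN => d.
  have [|z1 e1] := dl r1; first by have := degree_gt0 r1; have := degree_gt0 r2; lia.
  have [|z2 e2] := dl r2; first by have := degree_gt0 r1; have := degree_gt0 r2; lia.
  by move: lt; rewrite e1 e2; case: z1 z2 {e1 e2} => [] [].
exists (size s1), (size s2) => G G2 a b; have [f [<- <-]] := lift2 G2 a b.
rewrite -/x -/y -ev_hom -gmulfR -!gmulfXn -!gmulfM (evE u x y).
by rewrite -mulgA -(P s1) // E P.
Qed.

(** On [heis 0] the operation [ev u] is the product of [heis m], and [u'] evaluated in [heis m]
    gives back the product of [heis 0]. Comparison with the class two formula for [u'] makes 1 + 2m
    a unit. *)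
Lemma ev_comm1 u u' d : (1 < d)%N -> unital d u -> unital d u' ->
  (forall G : groupType, nilpotent_class_le d G ->
     forall a b : G, seval u (two a b) u' = a * b) ->
  agree 2 u \/ (forall G : groupType, nilpotent_class_le 2 G ->
     forall a b : G, ev u a b = b * a).
Proof.
move=> d1 U U' S; have d0 : 0 < d by exact: ltnW.
have [m1 [m2 E]] := agree_comm (agree1 d0 U).
have [k1 [k2 E']] := agree_comm (agree1 d0 U').
pose m : int := (m2%:Z - m1%:Z)%R.
have evu (p q : heis 0) : ev u p q = heis_mul (p : heis m) (q : heis m).
  have := E _ (@heis_nilpotent 0) p q; rewrite heis_commE !heis_expE.
  case: (ev u p q) => [[r s] t]; case: p q => [[a b] c] [[a' b'] c'].
  rewrite !heisE /heis_mul /= !GRing.addr0 => -[-> -> e].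
  congr (_, _, _); rewrite /m.
  apply: (GRing.addIr (1 * (a * b' - a' * b) * m1%:Z + (a + a') * 0 +
     0 * ((a + a') * 0 - 0 * (b + b')))%R).
  by rewrite !GRing.addrA e; ring.
have sevE (p q : heis 0) w :
    seval u (two p q) w = eval (two (p : heis m) (q : heis m)) w.
  elim: w => [//|[z k] w IHw] /=; rewrite evu IHw.
  by case: k z => [] [].
pose p : heis 0 := (1, 0, 0)%R; pose q : heis 0 := (0, 1, 0)%R.
have := S _ (nilpotent_class_leW d1 (@heis_nilpotent 0)) p q; rewrite sevE => e.
have := E' _ (@heis_nilpotent m) p q.
rewrite heis_commE !heis_expE {1}/ev e !heisE /heis_mul /= => -[] e3.
(* The third coordinates give m + (1 + 2m)(k2 - k1) = 0; double this and add 1. *)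
have {e3} : ((1 + 2%:Z * m) * (1 + 2%:Z * (k2%:Z - k1%:Z)) = 1)%R.
  clearbody m; move: e3; rewrite !(GRing.mul1r, GRing.mulr0, GRing.mul0r, GRing.addr0, GRing.add0r, GRing.subr0, GRing.mulr1) => e3.
  have -> : ((1 + 2%:Z * m) * (1 + 2%:Z * (k2%:Z - k1%:Z)) =
      1 + 2%:Z * ((1 + m + (1 + 2%:Z * m) * k2%:Z) - (1 + (1 + 2%:Z * m) * k1%:Z)))%R by ring.
  by rewrite -e3 GRing.subrr GRing.mulr0 GRing.addr0.
move=> e3; have [m0|m0] : m = 0%R \/ m = (-1)%R.
  have /eqP : absz ((1 + 2%:Z * m) * (1 + 2%:Z * (k2%:Z - k1%:Z)))%R = 1%N by rewrite e3.
  by rewrite abszM muln_eq1 => /andP[/eqP + _]; clearbody m; lia.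
- left=> G G2 a b; have := E G G2 a b.
  have -> : m1 = m2 by lia.
  exact: mulIg.
(* For m = -1 the law is ab [a, b]^-1 = ba. *)
- right=> G G2 a b; have := E G G2 a b.
  have -> : m1 = m2.+1 by lia.
  rewrite expgS mulgA => /mulIg eC; apply: (@mulIg _ [~ a, b]).
  by rewrite eC -commgC.
Qed.

Definition swap (u : word bool) : word bool := [seq (~~ l.1, l.2) | l <- u].

Lemma ev_swap u (G : groupType) (a b : G) : ev (swap u) a b = ev u b a.
Proof. by rewrite /ev /swap eval_map; apply: eq_eval => -[]. Qed.

Lemma agree_all u d : assoc d u -> agree 2 u -> (1 < d)%N -> agree d u.
Proof.
move=> A u2 d1; suff H n : (n.+2 <= d)%N -> agree n.+2 u by case: d d1 {A} H => [|[|d]] // _ /(_ d); apply.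
elim: n => [//|n IHn] nd; apply: agree_step => //; first by apply: IHn; exact: ltnW.
move=> G Gn; apply: A; exact: nilpotent_class_leW Gn.
Qed.

Lemma agree_or_swap d u u' : (1 < d)%N -> unital d u -> assoc d u -> unital d u' ->
  (forall G : groupType, nilpotent_class_le d G ->
     forall a b : G, seval u (two a b) u' = a * b) ->
  agree d u \/ agree d (swap u).
Proof.
move=> d1 U A U' S; have [u2|u2] := ev_comm1 d1 U U' S; [left|right].
  exact: agree_all.
apply: agree_all => //; last by move=> G G2 a b; rewrite ev_swap u2.
by move=> G Gd a b c; rewrite !ev_swap A.
Qed.

Local Open Scope fset_scope.


(** * Automorphisms of the category *)

Section Automorphism.
Variable C : category.

(** Equal functors still have morphisms in different hom types; a natural isomorphism avoids
    transport along equalities of objects. *)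
Lemma functor_eq_iso (D : category) (F F' : functor C D) : F = F' ->
  exists t : forall A : C, hom (F A) (F' A),
    (forall A : C, is_iso (t A)) /\
    (forall (A B : C) (f : hom A B), Defs.comp (fmap F' f) (t A) = Defs.comp (t B) (fmap F f)).
Proof.
move=> ->; exists (fun A => idm _); split=> [A|A B f]; last by rewrite comp1m compm1.
by exists (idm _); rewrite comp1m.
Qed.

Variables F G : functor C C.
Hypotheses (GF : functor_comp G F = functor_id C).

Lemma left_inverse_faithful (A B : C) (f g : hom A B) : fmap F f = fmap F g -> f = g.
Proof.
move=> fg; have [t [ti tn]] := functor_eq_iso GF.
have E : Defs.comp f (t A) = Defs.comp g (t A).
  by rewrite -[f]/(fmap (functor_id C) f) -[g]/(fmap (functor_id C) g) !tn /= fg.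
have [s [_ ts]] := ti A.
by rewrite -[f]compm1 -[g]compm1 -ts !Defs.compA E.
Qed.

End Automorphism.

(** The preimage is [fmap G h], carried along the isomorphism of G F with the identity. That F maps
    it to [h] is checked after applying the faithful functor G. *)
Lemma automorphism_full (C : category) (F G : functor C C) (A B : C)
    (h : hom (F A) (F B)) :
  functor_comp G F = functor_id C -> functor_comp F G = functor_id C ->
  exists f : hom A B, fmap F f = h.
Proof.
move=> GF FG; have [t [ti tn]] := functor_eq_iso GF.
have [sA [tsA stA]] := ti A; have [sB [tsB stB]] := ti B.
pose f : hom A B := Defs.comp (t B) (Defs.comp (fmap G h) sA).
exists f; apply: (left_inverse_faithful FG).
have E : Defs.comp f (t A) = Defs.comp (t B) (fmap (functor_comp G F) f) by exact: tn.
have L : Defs.comp sB (Defs.comp f (t A)) = fmap G h.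
  by rewrite /f -!Defs.compA tsA compm1 Defs.compA tsB comp1m.
have R : Defs.comp sB (Defs.comp (t B) (fmap (functor_comp G F) f)) =
    fmap (functor_comp G F) f by rewrite Defs.compA tsB comp1m.
by rewrite -L E R.
Qed.

Section Hom.
Variables (G H : groupType) (f : G -> H).
Hypothesis fM : {morph f : x y / x * y}.

Fact mult_morphism : monoid_morphism f.
Proof.
split=> //; apply: (@mulgI _ (f 1)).
by rewrite -fM !mulg1.
Qed.

HB.instance Definition _ := isUMagmaMorphism.Build G H f mult_morphism.
Definition mult_hom : group_hom G H := f.

End Hom.

Lemma lift_hom d (X : choiceType) (G : groupType) (a : X -> G) :
  nilpotent_class_le d G -> exists f : group_hom (free_nil d X) G,
    forall x, f (free_nil_gen d x) = a x.
Proof. by move=> Gd; exists (free_nil_lift Gd a) => x; exact: free_nil_liftE. Qed.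

(** * Automorphisms preserve the rank *)

Section Rank.
Variables (d : nat) (d0 : 0 < d).

Definition retract (X Y : {fset nat}) : Prop :=
  exists (i : whom d X Y) (r : whom d Y X), wcomp r i = widm d X.

(* A retraction of W(Y) onto W(X) makes Hom(W(Y), Z/2) at least as large as
   Hom(W(X), Z/2). *)
Lemma retract_card (X Y : {fset nat}) : retract X Y -> #|` X| <= #|` Y|.
Proof.
move=> [i [r ri]]; rewrite !cardfE.
pose Z2 : groupType := 'I_2.
have Z2d : nilpotent_class_le d Z2.
  apply: (@nilpotent_class_leW 1) => // x.
  elim=> [_ [y [z [_ ->]]]|//|y z _ -> _ ->|y _ ->]; rewrite ?mulg1 ?invg1 //.
  by apply/eqP/commgP; exact: GRing.addrC.
pose lft (phi : {ffun X -> Z2}) : group_hom (W d X) Z2 := free_nil_lift Z2d phi.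
pose Phi (phi : {ffun X -> Z2}) : {ffun Y -> Z2} :=
  [ffun y => lft phi (r (free_nil_gen d y))].
have inj : injective Phi.
  move=> p q /ffunP pq; apply/ffunP => x.
  have E : (lft p \o r : group_hom _ _) = (lft q \o r : group_hom _ _).
    apply: (free_nil_hom_eq Z2d) => y; have := pq y; rewrite !ffunE; by [].
  have ri' z : r (i z) = z by exact: (congr1 (fun h : whom d X X => h z) ri).
  have := congr1 (fun h : group_hom (W d Y) Z2 => h (i (free_nil_gen d x))) E.
  by rewrite /= -![free_nil_lift_fun _ _]/(lft _ _) ri' !free_nil_liftE.
have := leq_card _ inj; rewrite !card_ffun card_ord leq_exp2l //.
Qed.

Lemma card_retract (X Y : {fset nat}) : #|` X| <= #|` Y| -> retract X Y.
Proof.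
rewrite !cardfE => XY.
pose h (x : X) : Y := enum_val (widen_ord XY (enum_rank x)).
have hI : injective h.
  by move=> x y /enum_val_inj/(congr1 val) /= /val_inj/enum_rank_inj.
have Wd Z : nilpotent_class_le d (W d Z) by exact: free_nil_nilpotent.
have [i iE] := lift_hom (fun x => free_nil_gen d (h x) : W d Y) (Wd Y).
(* Generators outside the image of [h] are sent to 1. *)
have [r rE] := lift_hom (fun y =>
  if [pick x | h x == y] is Some x then free_nil_gen d x else 1 : W d X) (Wd X).
exists i, r; apply: (free_nil_hom_eq (Wd X)) => x /=; rewrite iE rE.
by case: pickP => [x' /eqP/hI-> //|/(_ x)]; rewrite eqxx.
Qed.

Local Notation C := (nilpotent_free_category d).

Lemma retract_fmap (F : functor C C) (X Y : {fset nat}) :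
  retract X Y -> retract (F X) (F Y).
Proof.
move=> [i [r ri]]; pose i' : hom (X : C) Y := i; pose r' : hom (Y : C) X := r.
exists (fmap F i'), (fmap F r').
have /esym E := fmapM F r' i'; apply: (etrans E).
by rewrite [Defs.comp r' i']ri; exact: fmap1.
Qed.

(** Removing a point must lower the rank of the image: otherwise F(X) would be a retract of F(X -
    x), and G would make X a retract of X - x. *)
Lemma rank_le (F G : functor C C) :
  functor_comp G F = functor_id _ -> forall X : {fset nat}, #|` X| <= #|` F X|.
Proof.
move=> GF X; have GFE Y : G (F Y) = Y.
  exact: (congr1 (fun H : functor _ _ => H Y) GF).
move En: #|` X| => n; elim: n X En => // n IHn X Xn.
have [x xX] : exists x, x \in X.
  by apply/fset0Pn; rewrite -cardfs_gt0 Xn.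
have X'n : #|` X `\ x| = n by move: Xn; rewrite (cardfsD1 x) xX => -[].
rewrite (leq_ltn_trans (IHn _ X'n)) // ltnNge; apply/negP => /card_retract.
move=> /(retract_fmap G)/retract_card.
by rewrite !GFE X'n Xn ltnn.
Qed.

End Rank.

Lemma card2_fset (E : {fset nat}) : #|` E| = 2 ->
  exists e1 e2 : E, e1 != e2 /\ forall e : E, e = e1 \/ e = e2.
Proof.
rewrite cardfE => E2; have sE : size (enum {: E}) = 2 by rewrite -cardE.
case: (enum {: E}) sE (enum_uniq {: E}) (mem_enum {: E}) => [|e1 [|e2 []]] //= _.
rewrite inE andbT => e12 eE; exists e1, e2; split=> // e.
by have := eE e; rewrite !inE => /orP[]/eqP; [left|right].
Qed.

Lemma card1_fset (E : {fset nat}) : #|` E| = 1%N -> exists e0 : E, forall e : E, e = e0.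
Proof.
rewrite cardfE => E1; have sE : size (enum {: E}) = 1%N by rewrite -cardE.
case: (enum {: E}) sE (mem_enum {: E}) => [|e0 []] //= _ eE; exists e0 => e.
by have := eE e; rewrite inE => /eqP.
Qed.

Lemma free_nil_word2 d (X : choiceType) (e1 e2 : X) (p : free_nil d X) :
  e1 != e2 -> (forall e, e = e1 \/ e = e2) ->
  exists u : word bool, forall (G : groupType) (f : group_hom (free_nil d X) G),
    f p = ev u (f (free_nil_gen d e1)) (f (free_nil_gen d e2)).
Proof.
move=> e12 eE; have [v ->] := free_nil_evalE p.
exists [seq (l.1 == e2, l.2) | l <- v] => G f.
rewrite /ev (eval_map (fun e => e == e2)) eval_hom; apply: eq_eval => e /=.
by have [->|->] := eE e; rewrite ?eqxx // (negPf e12).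
Qed.

Lemma seval_hom u (X : Type) (G H : groupType) (f : group_hom G H) (a : X -> G)
  (w : word X) : f (seval u a w) = seval u (f \o a) w.
Proof.
elim: w => [|[x b] w IHw] /=; first exact: gmulf1.
by rewrite ev_hom IHw; case: b => //=; rewrite gmulfV.
Qed.

(** * The group law pulled back along a natural bijection *)

Section Automorphisms.
Variables (d : nat) (d1 : 1 < d).
Local Notation C := (nilpotent_free_category d).
Variables F G : functor C C.
Hypotheses (GF : functor_comp G F = functor_id C)
           (FG : functor_comp F G = functor_id C).
Implicit Types X Y : {fset nat}.

Let d0 : 0 < d := ltnW d1.
Let Wd X : nilpotent_class_le d (W d X) := @free_nil_nilpotent d X.

Definition fmapW X Y (f : whom d X Y) : whom d (F X) (F Y) :=
  fmap F (f : hom (X : C) Y).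

Lemma fmapWM X Y Z (g : whom d Y Z) (f : whom d X Y) p :
  fmapW (wcomp g f) p = fmapW g (fmapW f p).
Proof.
exact: (congr1 (fun h : whom d (F X) (F Z) => h p) (fmapM F (g : hom (Y : C) Z) f)).
Qed.

Lemma rank_fobj X : #|` F X| = #|` X|.
Proof.
apply/eqP; rewrite eqn_leq (rank_le d0 GF) andbT.
have := rank_le d0 FG (F X).
by rewrite (congr1 (fun H : functor C C => H X) GF : G (F X) = X).
Qed.

Definition natural_bij (s : forall X, W d X -> W d (F X)) : Prop :=
  (forall X, bijective (s X)) /\
  (forall X Y (f : whom d X Y) p, fmapW f (s X p) = s Y (f p)).

(* W({0}) represents the underlying set functor, and so does its image. *)
Lemma exists_natural_bij : exists s, natural_bij s.
Proof.
pose X0 : {fset nat} := [fset 0%N].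
have [z0 z0E] : exists e0 : X0, forall e : X0, e = e0.
  by apply: card1_fset; rewrite cardfs1.
have [y0 y0E] : exists e0 : F X0, forall e : F X0, e = e0.
  by apply: card1_fset; rewrite rank_fobj cardfs1.
have z0_eq Y (f g : whom d X0 Y) :
    f (free_nil_gen d z0) = g (free_nil_gen d z0) -> f = g.
  by move=> fg; apply: (free_nil_hom_eq (@Wd Y)) => x; rewrite (z0E x).
have y0_eq Y (f g : whom d (F X0) Y) :
    f (free_nil_gen d y0) = g (free_nil_gen d y0) -> f = g.
  by move=> fg; apply: (free_nil_hom_eq (@Wd Y)) => x; rewrite (y0E x).
pose hat X (p : W d X) : whom d X0 X := free_nil_lift (@Wd X) (fun=> p).
have hatE X p : hat X p (free_nil_gen d z0) = p by exact: free_nil_liftE.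
have hat_eq X (f : whom d X0 X) : hat X (f (free_nil_gen d z0)) = f.
  by apply: z0_eq; rewrite hatE.
exists (fun X p => fmapW (hat X p) (free_nil_gen d y0)); split=> [X|X Y f p].
  have surj q : exists p, fmapW (hat X p) (free_nil_gen d y0) = q.
    pose h : whom d (F X0) (F X) := free_nil_lift (@Wd (F X)) (fun=> q).
    have [f fE] := automorphism_full (h : hom (F X0) (F X)) GF FG.
    exists ((f : whom d X0 X) (free_nil_gen d z0)); rewrite hat_eq /fmapW fE.
    exact: free_nil_liftE.
  have inj : injective (fun p => fmapW (hat X p) (free_nil_gen d y0)).
    move=> p q /y0_eq/(left_inverse_faithful GF) E.
    by rewrite -(hatE X p) -(hatE X q) E.
  pose inv q := projT1 (cid (surj q)).
  exists inv => [p|q]; last by rewrite /inv; case: cid.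
  by apply: inj; rewrite /inv; case: cid.
rewrite -fmapWM; congr (fmapW _ _); apply: z0_eq.
by rewrite hatE /= -/(hat X p) hatE.
Qed.

Section Transport.
Variable s : forall X, W d X -> W d (F X).
Hypothesis sN : natural_bij s.

Let s_inj X : injective (@s X).
Proof. by have [+ _] := sN => /(_ X)/bij_inj. Qed.

Let s_nat X Y (f : whom d X Y) p : fmapW f (s p) = s (f p).
Proof. by have [_ ->] := sN. Qed.

Let s_surj X q : exists p, @s X p = q.
Proof. by have [+ _] := sN => /(_ X)[t _ st]; exists (t q). Qed.

(** [p] is the pulled-back product of two free generators; naturality of [s] carries its word to all
    pairs. *)
Lemma transport_word : exists u, forall X (a b : W d X), s (ev u a b) = s a * s b.
Proof.
have [e1 [e2 [e12 eE]]] : exists e1 e2 : [fset 0%N; 1%N],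
    e1 != e2 /\ forall e, e = e1 \/ e = e2.
  by apply: card2_fset; rewrite cardfs2.
have [p pE] := s_surj (s (free_nil_gen d e1) * s (free_nil_gen d e2)).
have [u uE] := free_nil_word2 p e12 eE; exists u => X a b.
pose f : whom d _ X := free_nil_lift (@Wd X) (fun e => if e == e2 then b else a).
have f1 : f (free_nil_gen d e1) = a.
  by rewrite [LHS]free_nil_liftE (negPf e12).
have f2 : f (free_nil_gen d e2) = b.
  by rewrite [LHS]free_nil_liftE eqxx.
rewrite -{1}f1 -{1}f2 -uE -s_nat pE gmulfM !s_nat f1 f2 //.
Qed.

(** Here the free generators are those of [F E], and a morphism out of [F E] must be recognised as
    some [fmap F f] before naturality applies; this is where fullness enters. *)
Lemma cotransport_word :
  exists u', forall X (a b : W d X), s (a * b) = ev u' (s a) (s b).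
Proof.
pose E : {fset nat} := [fset 0%N; 1%N].
have [e1 [e2 [e12 eE]]] : exists e1 e2 : F E, e1 != e2 /\ forall e, e = e1 \/ e = e2.
  by apply: card2_fset; rewrite rank_fobj cardfs2.
have [p1 p1E] := s_surj (free_nil_gen d e1 : W d (F E)).
have [p2 p2E] := s_surj (free_nil_gen d e2 : W d (F E)).
have [u uE] := free_nil_word2 (s (p1 * p2)) e12 eE; exists u => X a b.
pose h : whom d (F E) (F X) :=
  free_nil_lift (@Wd (F X)) (fun e => if e == e2 then s b else s a).
have [f fE] := automorphism_full (h : hom (F E) (F X)) GF FG.
have h1 : h (free_nil_gen d e1) = s a.
  by rewrite [LHS]free_nil_liftE (negPf e12).
have h2 : h (free_nil_gen d e2) = s b.
  by rewrite [LHS]free_nil_liftE eqxx.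
have sf q : h (s q) = s ((f : whom d E X) q) by rewrite -s_nat /fmapW fE.
have := uE _ h; rewrite h1 h2 => <-; rewrite sf gmulfM.
by congr (s (_ * _)); apply/esym/s_inj; rewrite -sf ?p1E ?p2E.
Qed.

Lemma transport_mult : exists2 t, natural_bij t &
  forall X, {morph t X : a b / a * b}.
Proof.
have [u uE] := transport_word; have [u' uE'] := cotransport_word.
have s1 X : s (1 : W d X) = 1.
  have E : ev u 1 1 = 1 :> W d X.
    by rewrite /ev; elim: (u) => [//|[z c] w IHw] /=; rewrite IHw; case: c z => [] []; rewrite /= ?invg1 mulg1.
  by have := uE X 1 1; rewrite E -{1}[s 1]mulg1 => /mulgI/esym.
(* Three generators are what associativity needs: any triple in a group of the variety is the image
   of a triple in [W d X3]. *)
pose X3 : {fset nat} := [fset 0%N; 1%N; 2%N].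
have in0 : 0%N \in X3 by rewrite !inE.
have in1 : 1%N \in X3 by rewrite !inE.
have in2 : 2%N \in X3 by rewrite !inE.
have lift3 (H : groupType) (Hd : nilpotent_class_le d H) (a b c : H) :
    exists (f : group_hom (W d X3) H) x y z, [/\ f x = a, f y = b & f z = c].
  pose h (e : X3) := if val e == 0%N then a else if val e == 1%N then b else c.
  have [f fE] := lift_hom h Hd.
  by exists f, (free_nil_gen d [` in0]), (free_nil_gen d [` in1]),
    (free_nil_gen d [` in2]); rewrite !fE.
have U : unital d u.
  move=> H Hd a; have [f [x [_ [_ [<- _ _]]]]] := lift3 H Hd a a a.
  rewrite -[1](gmulf1 : f 1 = 1) -!ev_hom; split; congr (f _); apply: s_inj.
    by rewrite uE s1 mulg1.
  by rewrite uE s1 mul1g.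
have A : assoc d u.
  move=> H Hd a b c; have [f [x [y [z [<- <- <-]]]]] := lift3 H Hd a b c.
  by rewrite -!ev_hom; congr (f _); apply: s_inj; rewrite !uE mulgA.
(* [u'] describes the law on the image side, so its unit laws are read off at the generator of
   [F X0], of rank one. *)
have U' : unital d u'.
  move=> H Hd a; pose X0 : {fset nat} := [fset 0%N].
  have [y0 y0E] : exists e0 : F X0, forall e : F X0, e = e0.
    by apply: card1_fset; rewrite rank_fobj cardfs1.
  have [f fE] := lift_hom (fun _ : F X0 => a) Hd.
  have [p pE] := s_surj (free_nil_gen d y0 : W d (F X0)).
  rewrite -(fE y0) -[1](gmulf1 : f 1 = 1) -!ev_hom -pE -(s1 X0) -!uE'.
  by rewrite mulg1 mul1g.
have u1 := agree1 d0 U.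
(* An element commutes with its inverse, so both laws have the same inverses, as [seval]
   presupposes. *)
have sV X (a : W d X) : s a^-1 = (s a)^-1.
  have E : ev u a a^-1 = 1.
    rewrite evE (corr_commute u1 (@Wd X)) ?mulg1 ?mulgV //.
    exact/commuteV/commute_refl.
  by apply/esym/mulg1_eq; rewrite -uE E s1.
(* Under [s] the operation [ev u] becomes the product of the target, where [u'] computes
   [s (x * y)]. *)
have S (H : groupType) : nilpotent_class_le d H ->
    forall a b : H, seval u (two a b) u' = a * b.
  move=> Hd a b; have [f [x [y [_ [<- <- _]]]]] := lift3 H Hd a b a.
  have -> : seval u (two (f x) (f y)) u' = f (seval u (two x y) u').
    rewrite seval_hom; congr (seval u _ u'); apply/funext; by case.
  have <- : f (x * y) = f x * f y by exact: gmulfM.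
  congr (f _); apply: s_inj.
  rewrite uE' /ev; elim: (u') => [|[z c] w IHw] /=; first exact: s1.
  by rewrite uE IHw; case: c z => [] []; rewrite /= ?sV.
have [ag|ag] := agree_or_swap d1 U A U' S.
  by exists s => // X a b; rewrite -uE ag.
have anti X (a b : W d X) : s (a * b) = s b * s a.
  by rewrite -uE -(ag _ (@Wd X)) ev_swap.
exists (fun X p => (s p)^-1) => [|X a b]; last by rewrite anti invgM.
split=> [X|X Y f p]; last by rewrite gmulfV s_nat.
have [+ _] := sN => /(_ X)[t st ts]; exists (fun q => t q^-1) => q.
  by rewrite invgK st.
by rewrite ts invgK.
Qed.

End Transport.

Lemma automorphism_inner : exists s : forall A : C, hom A (F A),
  (forall A : C, is_iso (s A)) /\
  (forall (A B : C) (f : hom A B), Defs.comp (fmap F f) (s A) = Defs.comp (s B) f).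
Proof.
have [s0 s0N] := exists_natural_bij.
have [t [tb tn] tM] := transport_mult s0N.
exists (fun X => mult_hom (tM X)); split=> [X|X Y f]; last first.
  by apply: group_hom_eq => p; exact: tn.
have [r rt tr] := tb X.
have rM : {morph r : a b / a * b}.
  by move=> a b; apply: (can_inj rt); rewrite tM !tr.
exists (mult_hom rM : hom (F X : C) X).
by split; apply: group_hom_eq => p; [exact: rt | exact: tr].
Qed.

End Automorphisms.

Theorem theorem2p1 (d : nat) (hd : 2 <= d) :
  Aut (nilpotent_free_category d) = Inn (nilpotent_free_category d).
Proof.
apply/seteqP; split=> [F AF|F []//]; split=> //.
have [G [GF FG]] := AF; exact (automorphism_inner hd GF FG).
Qed.
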